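(* Let $0<\alpha<1$ and $\theta>-\alpha$. Let $(V_j)_{j\geq 1}$ be independent random variables with $V_j\sim\mathrm{beta}(1-\alpha,\theta+j\alpha)$, let $T_n=\sum_{i=1}^n Y_i$ with $Y_i=-\log(1-V_i)$, and for $t\geq 0$ let $N(t)=\max\{n:\ T_n\leq t\}$. Then there is a random variable $T_{\alpha,\theta}$, defined on the same probability space as $(V_j)_{j\ge 1}$ and having density $f_{\alpha,\theta}(t)=\frac{\Gamma(\theta+1)}{\Gamma(\theta/\alpha+1)}\,t^{-\theta}f_\alpha(t)$, $t>0$, such that $$t-\Big(\frac1\alpha-1\Big)\log N(t)+\log\alpha\ \longrightarrow\ \log T_{\alpha,\theta}\quad\text{almost surely as } t\to\infty.$$
   Context: Here $f_\alpha$ denotes the density on $(0,\infty)$ of a positive stable random variable $T_\alpha$ with exponent $\alpha$, i.e. one with Laplace transform $\mathrm{E}(e^{-sT_\alpha})=e^{-s^\alpha}$ for $s\geq 0$. The law with density $f_{\alpha,\theta}$ is the polynomially tilted positive stable law. The distribution $\mathrm{beta}(a,b)$ has density proportional to $v^{a-1}(1-v)^{b-1}$ on $(0,1)$. Convention: $T_0=0$, so that $N(t)=0$ when $T_1>t$; $N(t)$ is the renewal counting process associated with the renewal epochs $(T_n)_{n\geq 1}$. *)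

(* Defs.v *)
From mathcomp Require Import all_boot all_order all_algebra finmap.
From mathcomp Require Import all_classical all_reals all_analysis.
Set Implicit Arguments.
Unset Strict Implicit.
Unset Printing Implicit Defensive.
Import Order.TTheory GRing.Theory Num.Theory.
Import numFieldNormedType.Exports.
Local Open Scope classical_set_scope.
Local Open Scope ring_scope.

(* The law [mu] is carried by [D] and is absolutely continuous there, with
   density [f]; the values of [f] outside [D] are irrelevant. *)
Definition has_density_on (R : realType) (mu : set R -> \bar R) (D : set R)
    (f : R -> R) : Prop :=
  [/\ measurable_fun D f,
      forall x, D x -> 0 <= f x &
      forall A : set R, measurable A ->
        mu A = (\int[lebesgue_measure]_(x in A `&` D) (f x)%:E)%E].

Definition independent_RVs d (T : measurableType d) (R : realType)
    (P : probability T R) (X : nat -> {RV P >-> R}) : Prop :=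
  forall (J : {fset nat}) (A : nat -> set R),
    (forall j, j \in J -> measurable (A j)) ->
    P (\bigcap_(j in [set` J]) (X j @^-1` A j)) =
    (\prod_(j <- J) P (X j @^-1` A j))%E.

Definition Gamma (R : realType) (x : R) : R :=
  \int[lebesgue_measure]_(t in `]0, +oo[) (t `^ (x - 1) * expR (- t)).

(* [beta_fun] and [beta_pdf] of the library only accept natural parameters. *)
Definition beta_kernel (R : realType) (a b v : R) : R :=
  v `^ (a - 1) * (1 - v) `^ (b - 1).

Definition beta_density (R : realType) (a b v : R) : R :=
  beta_kernel a b v / \int[lebesgue_measure]_(u in `]0, 1[) beta_kernel a b u.

Definition is_beta d (T : measurableType d) (R : realType)
    (P : probability T R) (a b : R) (X : {RV P >-> R}) : Prop :=
  has_density_on (distribution P X) `]0, 1[ (beta_density a b).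

(* [mu] is the law of the positive stable variable; at [s = 0] the equation
   reads [1 = 1] because [0 `^ alpha = 0] for [alpha != 0]. *)
Definition is_positive_stable_density (R : realType) (alpha : R)
    (f : R -> R) : Prop :=
  exists mu : probability (measurableTypeR R) R,
    has_density_on mu `]0, +oo[ f /\
    forall s : R, 0 <= s ->
      ('E_mu[fun x : R => expR (- (s * x))] = (expR (- (s `^ alpha)))%:E)%E.

Definition tilted_stable_density (R : realType) (alpha theta : R)
    (f_alpha : R -> R) (t : R) : R :=
  Gamma (theta + 1) / Gamma (theta / alpha + 1) * t `^ (- theta) * f_alpha t.

(* Sequences are indexed from 0: [V j] stands for V_(j+1), so that
   [renewal_epoch V n] is T_n = Y_1 + ... + Y_n, with T_0 = 0. *)
Definition renewal_epoch (T : Type) (R : realType) (V : nat -> T -> R)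
    (n : nat) (w : T) : R :=
  \sum_(i < n) - ln (1 - V i w).

(* The maximum of {n | T_n <= t}, with value 0 if there is no maximum (this
   can only happen when the epochs T_n do not tend to infinity). *)
Definition renewal_count (T : Type) (R : realType) (V : nat -> T -> R)
    (t : R) (w : T) : nat :=
  let A := [set n | renewal_epoch V n w <= t] in
  xget 0%N (A `&` [set n | forall m, A m -> (m <= n)%N]).

(* Main.v *)
Require Import Defs.
From HB Require Import structures.
From mathcomp Require Import all_boot all_order all_algebra finmap.
From mathcomp Require Import all_classical all_reals all_analysis.
From mathcomp Require Import measurable_realfun.
From mathcomp Require Import ring lra.
Set Implicit Arguments.
Unset Strict Implicit.
Unset Printing Implicit Defensive.
Import Order.TTheory GRing.Theory Num.Theory.
Import numFieldNormedType.Exports HBNNSimple.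
Local Open Scope classical_set_scope.
Local Open Scope ring_scope.

(** Write T_n for the renewal epochs, and let S be positive stable with
    exponent alpha.  The proof rests on one explicit transform,
      m(p) = E S^(-p) = Gamma(p / alpha + 1) / Gamma(p + 1),   p > - alpha
    ([stable_moment], [stable_mellin]).  The moment of order s of the factor
    1 - V_j is a product of quotients of values of m at the consecutive points
    theta + (j - 1) alpha and theta + j alpha, shifted by 0 and by s.  By
    independence these quotients multiply and telescope ([renewal_moment]):
      E e^(-s T_n) = m(theta + s) / m(theta)
                     * m(theta + n alpha) / m(theta + n alpha + s).
    Let X_n = (1/alpha - 1) log n - log alpha - T_n.  Wendel's inequality for
    quotients of Gamma functions gives
      E e^(s X_n) = m(theta + s) / m(theta) * (1 + O(1/n)),   s >= 0
    ([centred_epoch_moment], [near1_moment_ratio]), where m(theta + s) / m(theta)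
    is the moment of order - s of the tilted stable law.

    Almost sure convergence of X_n.  For k <= n the same formula for the
    increments yields E (e^(X_n - X_k) - 1)^2 = O(1/k)
    ([centred_increment_sq]).  Along the grid of fourth powers the increments
    are then almost surely absolutely summable.  Between grid points T_n is
    monotone and log n varies little, so the whole sequence converges
    ([centred_epoch_cvg_ae]).

    Law of the limit.  Let X = lim X_n and T = e^(-X).  The moments
    m(theta + k alpha) / m(theta) of the variable T^(-alpha) grow slowly enough
    for s^k / k! times the moment of order k to tend to 0
    ([mittag_leffler_term_cvg0]), so that the Taylor sums of the exponential
    determine its Laplace transform ([limit_laplace]).  The tilted stable
    variable has the same moments of these orders, and a law on the half-line
    is determined by its Laplace transform ([laplace_unique]).  Hence T has the
    tilted density ([epoch_limit_density]).

    Counting process.  By definition T_N(t) <= t < T_(N(t)+1), so that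
    t - (1/alpha - 1) log N(t) + log alpha lies between two sequences that
    tend to - X = log T, taken at N(t) ([renewal_count_asymp]). *)

(** * Integrals against laws and densities *)

(** The passage from indicators to nonnegative functions, by monotone limits
    of simple functions.  With [X] the identity it turns a density into an
    integration formula; with [F] a product of the other factors it frees one
    factor of an independent product from being an indicator. *)
Lemma ge0_integral_weighted_law d d' (T : measurableType d)
    (U : measurableType d') (R : realType) (m : {measure set T -> \bar R})
    (mu : {measure set U -> \bar R}) (F : T -> R) (X : T -> U) (c : R)
    (g : U -> R) :
  measurable_fun setT F -> (forall x, 0 <= F x) -> measurable_fun setT X ->
  0 <= c ->
  (forall A, measurable A ->
    (\int[m]_x (F x * \1_A (X x))%:E = c%:E * mu A)%E) ->
  measurable_fun setT g -> (forall u, 0 <= g u) ->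
  (\int[m]_x (F x * g (X x))%:E = c%:E * \int[mu]_u (g u)%:E)%E.
Proof.
move=> mF F0 mX c0 H mg g0.
have mEg : measurable_fun [set: U] (EFin \o g) by exact/measurable_EFinP.
pose h := nnsfun_approx measurableT mEg.
have hg u : (EFin \o h ^~ u) n @[n --> \oo] --> (g u)%:E.
  by apply: (cvg_nnsfun_approx measurableT mEg) => // x _; rewrite lee_fin.
have hnd u a b : (a <= b)%N -> h a u <= h b u.
  by move=> ab; exact/lefP/nd_nnsfun_approx.
have -> : (\int[mu]_u (g u)%:E = limn (fun n => \int[mu]_u (h n u)%:E))%E.
  rewrite -monotone_convergence//.
  - by apply: eq_integral => u _; apply/esym/cvg_lim => //; exact: hg.
  - by move=> n; apply/measurable_EFinP.
  - by move=> n x _; rewrite lee_fin.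
  - by move=> x _ a b ab; rewrite lee_fin hnd.
have mhX n : measurable_fun setT (fun x => h n (X x)).
  by apply: measurableT_comp.
have -> : (\int[m]_x (F x * g (X x))%:E =
    limn (fun n => \int[m]_x (F x * h n (X x))%:E))%E.
  rewrite -monotone_convergence//.
  - apply: eq_integral => u _; apply/esym/cvg_lim => //.
    under eq_fun do rewrite EFinM; rewrite EFinM.
    by apply: cvgeZl => //; exact: hg.
  - by move=> n; apply/measurable_EFinP/measurable_funM.
  - by move=> n x _; rewrite lee_fin mulr_ge0.
  - by move=> x _ a b ab; rewrite lee_fin ler_wpM2l// hnd.
have mu_cvg : cvgn (fun n => (\int[mu]_u (h n u)%:E)%E).
  apply: ereal_nondecreasing_is_cvgn => a b ab; apply: ge0_le_integral => //.
  - by move=> x _; rewrite lee_fin.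
  - by apply/measurable_EFinP.
  - by apply/measurable_EFinP.
  - by move=> x _; rewrite lee_fin hnd.
rewrite -limeMl//; congr (limn _); apply/funext => n.
transitivity (\int[m]_x (\sum_(y \in range (h n))
    (y%:E * (F x * \1_(h n @^-1` [set y]) (X x))%:E)))%E.
  apply: eq_integral => x _; rewrite (fimfunE (h n)) EFinM -fsumEFin//.
  rewrite ge0_mule_fsumr; last by move=> y; exact: nnfun_muleindic_ge0.
  by apply: eq_fsbigr => y _; rewrite -!EFinM; congr (_%:E); ring.
have mi y : measurable_fun setT (fun x => F x * \1_(h n @^-1` [set y]) (X x)).
  apply: measurable_funM => //; apply: measurableT_comp => //.
have pos y x : range (h n) y -> (0 <= y%:E * (F x * \1_(h n @^-1` [set y]) (X x))%:E)%E.
  by move=> [u _ <-]; rewrite -EFinM lee_fin !mulr_ge0.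
have pos' y x : (0 <= y%:E * (F x * \1_(h n @^-1` [set y]) (X x))%:E)%E.
  have [/pos //|nr] := pselect (range (h n) y).
  rewrite indicE memNset ?mulr0 ?mule0// => /= hy; apply: nr.
  by exists (X x).
rewrite ge0_integral_fsum//; last first.
  by move=> y; apply/measurable_EFinP; exact: measurable_funM.
transitivity (\sum_(y \in range (h n)) c%:E * (y%:E * mu (h n @^-1` [set y])))%E.
  apply: eq_fsbigr => y; rewrite inE => -[u _ <-].
  rewrite ge0_integralZl//.
  - rewrite H// muleCA//.
  - exact/measurable_EFinP.
  - by move=> x _; rewrite lee_fin mulr_ge0.
  - by rewrite lee_fin.
rewrite -ge0_mule_fsumr; last first.
  by move=> y; rewrite nnsfun_mulemu_ge0.
congr (_ * _)%E; transitivity (\int[mu]_u (\sum_(y \in range (h n))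
    (y * \1_(h n @^-1` [set y]) u)%:E))%E; last first.
  by apply: eq_integral => u _; rewrite fsumEFin// -fimfunE.
rewrite ge0_integral_fsum//; last 2 first.
  - move=> y; apply/measurable_EFinP; apply: measurable_funM => //.
  - by move=> y x _; exact: nnfun_muleindic_ge0.
apply: eq_fsbigr => y _; rewrite integralZl_indic_nnsfun//.
by rewrite integral_indic// setIT.
Qed.

Lemma ge0_integral_density (R : realType) (mu : {measure set R -> \bar R})
    (D : set R) (f g : R -> R) :
  measurable D -> has_density_on mu D f ->
  measurable_fun setT g -> (forall x, 0 <= g x) ->
  (\int[mu]_x (g x)%:E =
   \int[lebesgue_measure]_(x in D) (g x * f x)%:E)%E.
Proof.
move=> mD [mf f0 fE] mg g0.
have mfD : measurable_fun setT (f \_ D) by apply/(measurable_restrictT _ mD); exact: mf.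
have fD0 x : 0 <= (f \_ D) x.
  by rewrite patchE; case: ifPn => //; rewrite inE => /f0.
transitivity (1%:E * \int[mu]_x (g x)%:E)%E; first by rewrite mul1e.
rewrite -(@ge0_integral_weighted_law _ _ _ _ R lebesgue_measure mu (f \_ D) id 1 g)//.
- rewrite [RHS]integral_mkcond; apply: eq_integral => x _.
  rewrite !patchE; case: ifPn => // _; first by rewrite mulrC.
  by rewrite mul0r.
- move=> A mA; rewrite mul1e fE//.
  rewrite [RHS]integral_mkcond; apply: eq_integral => x _ /=.
  rewrite patchE [RHS]patchE in_setI; case: (boolP (x \in D)) => xD /=.
    by rewrite indicE; case: (x \in A); rewrite ?mulr1 ?mulr0.
  by rewrite andbF mul0r.
Qed.

Lemma bounded_integrable d (T : measurableType d) (R : realType)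
    (P : probability T R) (D : set T) (g : T -> R) (C : R) :
  measurable D -> measurable_fun D g -> (forall x, D x -> `|g x| <= C) ->
  P.-integrable D (EFin \o g).
Proof.
move=> mD mg gC; apply: (@le_integrable _ _ _ P D _ _ (cst C%:E)) => //.
- exact/measurable_EFinP.
- by move=> x /gC; rewrite /= lee_fin => /le_trans; apply; exact: ler_norm.
- apply: (@integrableS _ _ _ _ setT) => //.
  exact: finite_measure_integrable_cst.
Qed.

(** The integrand is extended by zero outside the rectangle. *)
Lemma fubini_tonelli_on (R : realType) (D E : set R) (f : R -> R -> R) :
  measurable D -> measurable E ->
  measurable_fun (D `*` E) (fun z => f z.1 z.2) ->
  (forall x y, D x -> E y -> 0 <= f x y) ->
  (\int[lebesgue_measure]_(x in D) \int[lebesgue_measure]_(y in E) (f x y)%:E =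
   \int[lebesgue_measure]_(y in E) \int[lebesgue_measure]_(x in D) (f x y)%:E)%E.
Proof.
move=> mD mE mf f0.
pose h z := ((fun z : R * R => f z.1 z.2) \_ (D `*` E)) z.
have mh : measurable_fun [set: R * R] (EFin \o h).
  by apply/measurable_EFinP/(measurable_restrictT _ _).1 => //; exact: measurableX.
have := fubini_tonelli (m1 := @lebesgue_measure R) (m2 := @lebesgue_measure R) _ mh.
have h0 z : (0 <= (EFin \o h) z)%E.
  rewrite lee_fin /h patchE; case: ifPn => //; rewrite inE => -[? ?].
  exact: f0.
move=> /(_ h0) H; transitivity (\int[lebesgue_measure]_x \int[lebesgue_measure]_y (EFin \o h) (x, y))%E.
  rewrite integral_mkcond; apply: eq_integral => x _.
  rewrite patchE; case: ifPn => xD.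
    rewrite integral_mkcond; apply: eq_integral => y _.
    by rewrite /h/= !patchE/= in_setX/= xD/=; case: ifPn.
  apply/esym/integral0_eq => y _.
  by rewrite /h/= patchE/= in_setX/= (negbTE xD).
rewrite H [RHS]integral_mkcond; apply: eq_integral => y _.
rewrite [RHS]patchE; case: ifPn => yE.
  rewrite [RHS]integral_mkcond; apply: eq_integral => x _.
  by rewrite /h/= !patchE/= in_setX/= yE/= andbT; case: ifPn.
apply/integral0_eq => x _.
by rewrite /h/= patchE/= in_setX/= (negbTE yE) andbF.
Qed.

(** * Change of variables onto the half-line *)

(** The substitution rule for continuous functions holds on each compact
    interval of an exhaustion of [D]; both sides then increase to the improper
    integrals, whether these are finite or not. *)
Lemma ge0_substitution_pos (R : realType) (D : set R) (a b : nat -> R)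
    (F f G : R -> R) :
  (forall n, a n < b n) -> nonincreasing_seq a -> nondecreasing_seq b ->
  D = \bigcup_n `[a n, b n]%classic ->
  (forall x y, D x -> D y -> x < y -> F x < F y) ->
  (forall x, D x -> is_derive x 1 F (f x)) ->
  (forall x, D x -> {for x, continuous f}) ->
  (forall x, D x -> 0 <= f x) ->
  (forall x, D x -> 0 < F x) ->
  (forall y : R, 0 < y -> exists2 x, D x & F x = y) ->
  (forall y : R, 0 < y -> {for y, continuous G}) ->
  (forall y : R, 0 < y -> 0 <= G y) ->
  (\int[lebesgue_measure]_(y in `]0%R, +oo[) (G y)%:E =
   \int[lebesgue_measure]_(x in D) (G (F x) * f x)%:E)%E.
Proof.
move=> ab na nb DE incF dF cf f0 F0 surjF cG G0.
have abD n x : a n <= x <= b n -> D x.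
  by move=> abx; rewrite DE; exists n => //=; rewrite in_itv.
have Da n : D (a n) by apply: (@abD n); rewrite lexx ltW.
have Db n : D (b n) by apply: (@abD n); rewrite lexx ltW.
have leF x y : D x -> D y -> x <= y -> F x <= F y.
  move=> Dx Dy; rewrite le_eqVlt => /predU1P[->//|xy].
  by rewrite ltW// incF.
have D'E : `]0, +oo[%classic = \bigcup_n `[F (a n), F (b n)]%classic.
  apply/seteqP; split=> [y|y [n _]]; rewrite /= !in_itv/= ?andbT; last first.
    by move=> /andP[+ _]; apply: lt_le_trans; exact: F0.
  move=> /surjF[x Dx <-]; move: (Dx); rewrite {1}DE => -[n _].
  by rewrite /= in_itv/= => /andP[? ?]; exists n => //=; rewrite in_itv/= !leF.
have cF x : D x -> {for x, continuous F}.
  by move=> Dx; apply/differentiable_continuous/derivable1_diffP; case: (dF x Dx).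
have cGF x : D x -> {for x, continuous (fun x => G (F x) * f x)}.
  move=> Dx; apply: continuousM; last exact: cf.
  by apply: continuous_comp; [exact: cF|apply/cG/F0].
have nI (u v : nat -> R) : nonincreasing_seq u -> nondecreasing_seq v ->
    nondecreasing_seq (fun n => `[u n, v n]%classic).
  move=> nu nv m n mn; apply/subsetPset => x /=; rewrite !in_itv/= => /andP[ux xv].
  by rewrite (le_trans (nu _ _ mn))//= (le_trans xv)//; exact: nv.
have mI (g : R -> R) (u v : R) : (forall x, u <= x <= v -> {for x, continuous g}) ->
    measurable_fun `[u, v] (EFin \o g).
  move=> cg; apply/measurable_EFinP; apply: subspace_continuous_measurable_fun => //.
  by apply: continuous_in_subspaceT => x; rewrite inE/= in_itv/= => /cg.
have lhs : (\int[lebesgue_measure]_(y in `[F (a n), F (b n)]) (G y)%:E)%E @[n --> \oo] -->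
   (\int[lebesgue_measure]_(y in `]0%R, +oo[) (G y)%:E)%E.
  rewrite D'E; apply: ge0_nondecreasing_set_cvg_integral => //.
  - by apply: nI => m n mn; apply: leF => //; [exact: na|exact: nb].
  - move=> n; apply: mI => x /andP[ax _]; apply: cG.
    by apply: lt_le_trans ax; exact: F0.
  - move=> n x; rewrite /= in_itv/= lee_fin => /andP[ax _]; apply: G0.
    by apply: lt_le_trans ax; exact: F0.
have rhs : (\int[lebesgue_measure]_(x in `[a n, b n]) (G (F x) * f x)%:E)%E @[n --> \oo] -->
   (\int[lebesgue_measure]_(x in D) (G (F x) * f x)%:E)%E.
  rewrite DE; apply: ge0_nondecreasing_set_cvg_integral => //.
  - exact: nI.
  - by move=> n; apply: mI => x /abD; exact: cGF.
  - move=> n x; rewrite /= in_itv/= lee_fin => /abD Dx.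
    by rewrite mulr_ge0 ?f0 ?G0 ?F0.
apply: cvg_unique lhs _ => //.
apply: cvg_trans rhs; apply: near_eq_cvg; apply: nearW => n.
rewrite integration_by_substitution_increasing.
- apply: eq_integral => x; rewrite inE/= in_itv/= => /abD Dx.
  by case: (dF _ Dx) => _ /= dFx; rewrite fctE derive1E dFx.
- exact: ltW.
- by move=> x y; rewrite !in_itv/= => /abD ? /abD ?; exact: incF.
- move=> x; rewrite in_itv/= => /andP[ax xb].
  have Dx : D x by apply: (@abD n); rewrite !ltW.
  have : f y @[y --> x] --> F^`()%classic x.
    case: (dF _ Dx) => _ /= dFx; rewrite derive1E dFx; exact: cf.
  apply: cvg_trans; apply: near_eq_cvg.
  near=> y; rewrite derive1E.
  have Dy : D y.
    apply: (@abD n); apply/andP; split; rewrite ltW//; near: y.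
      exact: lt_nbhsr.
    exact: lt_nbhsl.
  by case: (dF _ Dy) => _ /= ->.
- apply/cvg_ex; exists (f (a n)).
  have : f y @[y --> (a n)^'+] --> f (a n) by apply: cvg_at_right_filter; exact: cf.
  apply: cvg_trans; apply: near_eq_cvg; near=> y.
  have Dy : D y.
    by apply: (@abD n); apply/andP; split; rewrite ltW.
  by rewrite derive1E; case: (dF _ Dy) => _ /= ->.
- apply/cvg_ex; exists (f (b n)).
  have : f y @[y --> (b n)^'-] --> f (b n) by apply: cvg_at_left_filter; exact: cf.
  apply: cvg_trans; apply: near_eq_cvg; near=> y.
  have Dy : D y.
    by apply: (@abD n); apply/andP; split; rewrite ltW.
  by rewrite derive1E; case: (dF _ Dy) => _ /= ->.
- split.
  + move=> x; rewrite in_itv/= => /andP[ax xb].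
    have Dx : D x by apply: (@abD n); rewrite !ltW.
    by case: (dF _ Dx).
  + by apply: cvg_at_right_filter; exact: cF.
  + by apply: cvg_at_left_filter; exact: cF.
- apply: continuous_in_subspaceT => x; rewrite inE/= in_itv/= => /andP[ax _].
  by apply: cG; apply: lt_le_trans ax; exact: F0.
Unshelve. all: by end_near. Qed.

Lemma itv0y_bigcup (R : realType) :
  `]0, +oo[%classic = \bigcup_n `[n.+2%:R^-1, n.+2%:R]%classic :> set R.
Proof.
apply/seteqP; split=> [x|x [n _]]; rewrite /= !in_itv/= ?andbT; last first.
  by move=> /andP[+ _]; apply: lt_le_trans; rewrite invr_gt0 ltr0n.
move=> x0; pose n := Num.bound (x + x^-1).
have := archi_boundP (addr_ge0 (ltW x0) (ltW (eqbRL (invr_gt0 x) x0))).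
rewrite -/n => xn; exists n => //=; rewrite in_itv/=.
have nn : (n%:R : R) <= n.+2%:R by rewrite ler_nat -addn2 leq_addr.
have iv0 : 0 < x^-1 by rewrite invr_gt0.
apply/andP; split; last by lra.
by rewrite -[leRHS]invrK lef_pV2 ?posrE ?ltr0n //; lra.
Qed.

Lemma itv01_bigcup (R : realType) :
  `]0, 1[%classic = \bigcup_n `[n.+3%:R^-1, 1 - n.+3%:R^-1]%classic :> set R.
Proof.
apply/seteqP; split=> [x|x [n _]]; rewrite /= !in_itv/=; last first.
  have n0 : 0 < n.+3%:R^-1 :> R by rewrite invr_gt0 ltr0n.
  by move: n.+3%:R^-1 n0 => e e0 /andP[? ?]; apply/andP; split; lra.
move=> /andP[x0 x1].
have x'0 : 0 < 1 - x by lra.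
have iv0 : 0 < x^-1 by rewrite invr_gt0.
have jv0 : 0 < (1 - x)^-1 by rewrite invr_gt0.
pose n := Num.bound (x^-1 + (1 - x)^-1).
have := archi_boundP (addr_ge0 (ltW iv0) (ltW jv0)).
rewrite -/n => xn; exists n => //=; rewrite in_itv/=.
have nn : (n%:R : R) <= n.+3%:R by rewrite ler_nat -addn3 leq_addr.
have h1 : n.+3%:R^-1 <= x.
  by rewrite -[leRHS]invrK lef_pV2 ?posrE ?ltr0n //; lra.
have h2 : n.+3%:R^-1 <= 1 - x.
  by rewrite -[leRHS]invrK lef_pV2 ?posrE ?ltr0n //; lra.
by rewrite h1/=; move: n.+3%:R^-1 h2 => e h2; lra.
Qed.

Lemma ge0_substitution_0y (R : realType) (F f G : R -> R) :
  (forall x y : R, 0 < x -> x < y -> F x < F y) ->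
  (forall x : R, 0 < x -> is_derive x 1 F (f x)) ->
  (forall x : R, 0 < x -> {for x, continuous f}) ->
  (forall x : R, 0 < x -> 0 <= f x) ->
  (forall x : R, 0 < x -> 0 < F x) ->
  (forall y : R, 0 < y -> exists2 x : R, 0 < x & F x = y) ->
  (forall y : R, 0 < y -> {for y, continuous G}) ->
  (forall y : R, 0 < y -> 0 <= G y) ->
  (\int[lebesgue_measure]_(y in `]0%R, +oo[) (G y)%:E =
   \int[lebesgue_measure]_(x in `]0%R, +oo[) (G (F x) * f x)%:E)%E.
Proof.
move=> incF dF cf f0 F0 sF cG G0.
have memP (x : R) : `]0, +oo[%classic x <-> 0 < x by rewrite /= in_itv/= andbT.
apply: (@ge0_substitution_pos _ _ (fun n => n.+2%:R^-1) (fun n => n.+2%:R)) => //.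
- by move=> n; rewrite (@lt_trans _ _ 1) ?invf_lt1 ?ltr1n.
- by move=> m n mn; rewrite lef_pV2 ?posrE// ler_nat.
- by move=> m n mn; rewrite ler_nat.
- exact: itv0y_bigcup.
- by move=> x y /memP x0 _; exact: incF.
- by move=> x /memP; exact: dF.
- by move=> x /memP; exact: cf.
- by move=> x /memP; exact: f0.
- by move=> x /memP; exact: F0.
- by move=> y /sF[x x0 <-]; exists x => //; apply/memP.
Qed.

Lemma ge0_substitution_01 (R : realType) (F f G : R -> R) :
  (forall x y : R, 0 < x -> x < y -> y < 1 -> F x < F y) ->
  (forall x : R, 0 < x < 1 -> is_derive x 1 F (f x)) ->
  (forall x : R, 0 < x < 1 -> {for x, continuous f}) ->
  (forall x : R, 0 < x < 1 -> 0 <= f x) ->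
  (forall x : R, 0 < x < 1 -> 0 < F x) ->
  (forall y : R, 0 < y -> exists2 x : R, 0 < x < 1 & F x = y) ->
  (forall y : R, 0 < y -> {for y, continuous G}) ->
  (forall y : R, 0 < y -> 0 <= G y) ->
  (\int[lebesgue_measure]_(y in `]0%R, +oo[) (G y)%:E =
   \int[lebesgue_measure]_(x in `]0%R, 1%R[) (G (F x) * f x)%:E)%E.
Proof.
move=> incF dF cf f0 F0 sF cG G0.
have memP (x : R) : `]0, 1[%classic x <-> 0 < x < 1 by rewrite /= in_itv/=.
apply: (@ge0_substitution_pos _ _ (fun n => n.+3%:R^-1) (fun n => 1 - n.+3%:R^-1)) => //.
- move=> n; have : n.+3%:R^-1 < 2^-1 :> R by rewrite ltf_pV2 ?posrE// ltr_nat.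
  by move: n.+3%:R^-1 => e e2; lra.
- by move=> m n mn; rewrite lef_pV2 ?posrE// ler_nat.
- by move=> m n mn; rewrite lerD2l lerN2 lef_pV2 ?posrE// ler_nat.
- exact: itv01_bigcup.
- by move=> x y /memP/andP[x0 _] /memP/andP[_ y1] xy; exact: incF.
Qed.

(** * The Gamma function and the beta integral *)

Lemma powR_expR (R : realType) (x p : R) : 0 < x -> x `^ p = expR (p * ln x).
Proof. by move=> x0; rewrite /powR gt_eqF. Qed.

Lemma continuous_powR (R : realType) (p x : R) : 0 < x ->
  {for x, continuous (fun t : R => t `^ p)}.
Proof.
move=> x0; apply/differentiable_continuous/derivable1_diffP.
by apply: derivable_powR; rewrite in_itv/= x0.
Qed.

Lemma continuous_expRN (R : realType) (c x : R) :
  {for x, continuous (fun t : R => expR (- (c * t)))}.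
Proof.
apply: (@continuous_comp _ _ _ (fun t => - (c * t)) expR).
  by apply: continuousN; apply: mulrl_continuous.
exact: continuous_expR.
Qed.

Lemma continuous_Gamma_integrand (R : realType) (p x : R) : 0 < x ->
  {for x, continuous (fun t : R => t `^ p * expR (- t))}.
Proof.
move=> x0; apply: continuousM; first exact: continuous_powR.
have := @continuous_expRN R 1 x.
by rewrite (_ : (fun t => expR (- (1 * t))) = (fun t => expR (- t)))//;
  apply/funext => t; rewrite mul1r.
Qed.

Lemma integral_expRN (R : realType) (a : R) :
  (\int[lebesgue_measure]_(t in `]a, +oo[) (expR (- t))%:E = (expR (- a))%:E)%E.
Proof.
have ce (x : R) : {for x, continuous (fun t : R => expR (- t))}.
  have := @continuous_expRN R 1 x.
  by rewrite (_ : (fun t => expR (- (1 * t))) = (fun t => expR (- t)))//;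
    apply/funext => t; rewrite mul1r.
have dF (x : R) : is_derive x 1 (fun t : R => - expR (- t)) (expR (- x)).
  apply: is_derive_eq; rewrite /GRing.scale/=; ring.
have cF (x : R) : {for x, continuous (fun t : R => - expR (- t))}.
  by apply/differentiable_continuous/derivable1_diffP; case: (dF x).
have me : measurable_fun `]a, +oo[ (fun t : R => (expR (- t))%:E).
  apply/measurable_EFinP/measurable_funTS.
  by apply: continuous_measurable_fun => x; exact: ce.
rewrite (integral_itv_obnd_cbnd me).
rewrite (@ge0_continuous_FTC2y _ _ (fun t => - expR (- t)) _ 0).
- by rewrite sub0e EFinN oppeK.
- by move=> x _; exact: expR_ge0.
- by apply: continuous_subspaceT => x; exact: ce.
- rewrite -oppr0; apply: cvgN; exact: cvgr_expR.
- by move=> x _; case: (dF x).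
- by apply: cvg_at_right_filter; exact: cF.
- by move=> x _; rewrite derive1E; case: (dF x).
Qed.

(** With values in the extended reals the integral can be scaled, exchanged
    and substituted freely; that it is finite comes out of these very
    manipulations, in [eGamma_fin_num]. *)
Definition eGamma (R : realType) (x : R) : \bar R :=
  (\int[lebesgue_measure]_(t in `]0%R, +oo[) (t `^ (x - 1) * expR (- t))%:E)%E.

Lemma mem0y (R : realType) (x : R) : `]0, +oo[%classic x = (0 < x) :> Prop.
Proof. by rewrite /= in_itv/= andbT. Qed.

Lemma eGamma_ge0 (R : realType) (x : R) : (0 <= eGamma x)%E.
Proof.
by apply: integral_ge0 => t _; rewrite lee_fin mulr_ge0 ?powR_ge0 ?expR_ge0.
Qed.

Lemma eGamma1 (R : realType) : eGamma 1 = 1%E :> \bar R.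
Proof.
transitivity ((expR (- 0) : R)%:E); last by rewrite oppr0 expR0.
rewrite -integral_expRN.
by apply: eq_integral => t _; rewrite subrr powRr0 mul1r.
Qed.

Lemma measurable_itv_powM_expRN (R : realType) (D : set R) (p c : R) :
  measurable D ->
  measurable_fun D (fun t : R => t `^ p * expR (- (c * t))).
Proof.
move=> mD; apply: measurable_funTS; apply: measurable_funM.
  exact: measurable_powR.
apply: continuous_measurable_fun => x; exact: continuous_expRN.
Qed.

Lemma eGamma_scale (R : realType) (c x : R) : 0 < c ->
  (\int[lebesgue_measure]_(t in `]0%R, +oo[) (t `^ (x - 1) * expR (- (c * t)))%:E
   = (c `^ (- x))%:E * eGamma x)%E.
Proof.
move=> c0.
have -> : eGamma x = (\int[lebesgue_measure]_(t in `]0%R, +oo[)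
    (((c * t) `^ (x - 1) * expR (- (c * t))) * c)%:E)%E.
  apply: (@ge0_substitution_0y _ (fun t => c * t) (fun=> c)
    (fun t => t `^ (x - 1) * expR (- t))).
  - by move=> s t _ st; rewrite ltr_pM2l.
  - by move=> t _; apply: is_derive_eq; rewrite /GRing.scale/=; ring.
  - by move=> t _; exact: cst_continuous.
  - by move=> _ _; exact: ltW.
  - by move=> t t0; rewrite mulr_gt0.
  - by move=> y y0; exists (y / c); rewrite ?divr_gt0// mulrC divfK// gt_eqF.
  - by move=> y; exact: continuous_Gamma_integrand.
  - by move=> y _; rewrite mulr_ge0 ?powR_ge0 ?expR_ge0.
rewrite -ge0_integralZl//.
- apply: eq_integral => t; rewrite inE mem0y => t0.
  rewrite -EFinM; congr _%:E.
  rewrite powRM ?ltW//.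
  transitivity ((c `^ (- x) * c `^ (x - 1) * c) * (t `^ (x - 1) * expR (- (c * t)))); last by ring.
  have -> : c `^ (- x) * c `^ (x - 1) * c = 1.
    rewrite !(powR_expR _ c0) -[X in _ * _ * X]lnK ?posrE// -!expRD -[RHS]expR0.
    by congr expR; ring.
  by rewrite mul1r.
- apply/measurable_EFinP.
  apply: (@eq_measurable_fun _ _ _ _ _ (fun t => (c `^ (x - 1) * c) * (t `^ (x - 1) * expR (- (c * t))))).
    move=> t; rewrite inE mem0y => t0; rewrite powRM ?ltW//; ring.
  by apply: measurable_funM => //; exact: measurable_itv_powM_expRN.
- move=> t; rewrite mem0y => t0.
  by rewrite lee_fin !mulr_ge0 ?powR_ge0 ?expR_ge0 ?ltW.
- by rewrite lee_fin powR_ge0.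
Qed.

Lemma ltr_powR (R : realType) (p x y : R) : 0 < p -> 0 < x -> x < y ->
  x `^ p < y `^ p.
Proof.
move=> p0 x0 xy; rewrite !powR_expR//; last exact: lt_trans xy.
by rewrite ltr_expR ltr_pM2l// ltr_ln ?posrE//; exact: lt_trans xy.
Qed.

Lemma integral_powR_subst (R : realType) (p : R) (G : R -> R) : 0 < p ->
  (forall y : R, 0 < y -> {for y, continuous G}) ->
  (forall y : R, 0 < y -> 0 <= G y) ->
  (\int[lebesgue_measure]_(y in `]0%R, +oo[) (G y)%:E =
   \int[lebesgue_measure]_(t in `]0%R, +oo[)
     (G (t `^ p) * (p * t `^ (p - 1)))%:E)%E.
Proof.
move=> p0 cG G0.
apply: (@ge0_substitution_0y _ (fun t => t `^ p) (fun t => p * t `^ (p - 1))) => //.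
- by move=> x y x0 xy; exact: ltr_powR.
- move=> t t0; apply: continuousM; first exact: cst_continuous.
  exact: continuous_powR.
- by move=> t t0; rewrite mulr_ge0 ?powR_ge0// ltW.
- by move=> t t0; rewrite powR_gt0.
- move=> y y0; exists (y `^ p^-1); first exact: powR_gt0.
  by rewrite -powRrM mulVf ?gt_eqF// powRr1// ltW.
Qed.

Lemma lebesgue_measure_0x (R : realType) (x : R) : 0 < x ->
  lebesgue_measure `]0%R, x[%classic = x%:E.
Proof. by move=> x0; rewrite lebesgue_measure_itv/= lte_fin x0 oppr0 adde0. Qed.

Lemma measurable_set_ltr d (T : measurableType d) (R : realType)
    (f g : T -> R) : measurable_fun setT f -> measurable_fun setT g ->
  measurable [set z | f z < g z].
Proof.
move=> mf mg; have := @measurable_fun_ltr _ _ _ _ _ _ mf mg measurableT [set true].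
by rewrite setTI; apply.
Qed.

(** Tonelli in place of an integration by parts: t^x is the length of
    ]0, t^x[, and e^(-u^(1/x)) is the integral of e^(-t) over t^x > u.  The
    substitution u = t^x then brings back the Gamma integrand. *)
Lemma eGammaS (R : realType) (x : R) : 0 < x ->
  eGamma (x + 1) = (x%:E * eGamma x)%E.
Proof.
move=> x0.
pose h (u t : R) := \1_[set z : R * R | z.1 < z.2 `^ x] (u, t) * expR (- t).
have mS : measurable [set z : R * R | z.1 < z.2 `^ x].
  apply: (@measurable_set_ltr _ _ _ (fun z : R * R => z.1) (fun z : R * R => z.2 `^ x)).
    exact: measurable_fst.
  exact: (measurableT_comp (measurable_powR x) measurable_snd).
have h0 u t : 0 <= h u t by rewrite mulr_ge0 ?expR_ge0.
transitivity (\int[lebesgue_measure]_(t in `]0%R, +oo[)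
    \int[lebesgue_measure]_(u in `]0%R, +oo[) (h u t)%:E)%E.
  apply: eq_integral => t; rewrite inE mem0y => t0.
  rewrite addrK /h.
  transitivity (\int[lebesgue_measure]_(u in `]0%R, +oo[)
     ((expR (- t))%:E * (\1_`]0, t `^ x[ u)%:E))%E.
    rewrite ge0_integralZl//; last first.
      by apply/measurable_EFinP; exact: measurable_indic.
    rewrite integral_indic// EFinM muleC; congr (_ * _)%E.
    rewrite setIidl; first by apply/esym/lebesgue_measure_0x; rewrite powR_gt0.
    by move=> u /=; rewrite !in_itv/= => /andP[-> _].
  apply: eq_integral => u; rewrite inE mem0y => u0.
  rewrite -EFinM mulrC; congr (_ * _)%:E; rewrite !indicE; congr (_%:R).
  by congr nat_of_bool; apply/idP/idP; rewrite !inE/= in_itv/= u0.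
rewrite fubini_tonelli_on//; last first.
  apply: measurable_funTS; apply: measurable_funM.
    rewrite (_ : (fun z => _) = \1_[set z : R * R | z.2 < z.1 `^ x]); last first.
      by apply/funext => z; rewrite !indicE; congr (_%:R);
        congr nat_of_bool; apply/idP/idP; rewrite !inE.
    apply: measurable_indic.
    apply: (@measurable_set_ltr _ _ _ (fun z : R * R => z.2) (fun z : R * R => z.1 `^ x)).
      exact: measurable_snd.
    exact: (measurableT_comp (measurable_powR x) measurable_fst).
  apply: measurableT_comp => //.
  exact: measurableT_comp.
transitivity (\int[lebesgue_measure]_(u in `]0%R, +oo[) (expR (- (u `^ x^-1)))%:E)%E.
  apply: eq_integral => u; rewrite inE mem0y => u0.
  rewrite -integral_expRN.
  rewrite [RHS]integral_mkcond [LHS]integral_mkcond; apply: eq_integral => t _.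
  rewrite !patchE /h indicE.
  have [t0|t0] := ltP 0 t; last first.
    rewrite memNset; last by rewrite mem0y; apply/negP; rewrite -leNgt.
    rewrite memNset//= in_itv/= andbT; apply/negP; rewrite -leNgt.
    by rewrite (le_trans t0)// powR_ge0.
  rewrite (@mem_set _ `]0, +oo[%classic); last by rewrite mem0y.
  have ut : (u < t `^ x) = (u `^ x^-1 < t).
    apply/idP/idP => H.
      have := ltr_powR (eqbRL (invr_gt0 x) x0) u0 H.
      by rewrite -powRrM mulfV ?gt_eqF// powRr1// ltW.
    have := ltr_powR x0 (powR_gt0 x^-1 u0) H.
    by rewrite -powRrM mulVf ?gt_eqF// powRr1// ltW.
  case: ifPn; rewrite ?notin_setE ?inE/= in_itv/= andbT => H.
    by rewrite mem_set ?mul1r//= ut.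
  by rewrite memNset ?mul0r//= ut.
rewrite (@integral_powR_subst _ x (fun u => expR (- (u `^ x^-1)))) //.
- rewrite -ge0_integralZl//.
  + apply: eq_integral => t; rewrite inE mem0y => t0.
    by rewrite -powRrM mulfV ?gt_eqF// powRr1 ?ltW// -EFinM; congr _%:E; ring.
  + apply/measurable_EFinP.
    apply: (@eq_measurable_fun _ _ _ _ _
      (fun t => t `^ (x - 1) * expR (- (1 * t)))); first by move=> t _; rewrite mul1r.
    exact: measurable_itv_powM_expRN.
  + by move=> t _; rewrite lee_fin mulr_ge0 ?powR_ge0 ?expR_ge0.
  + by rewrite lee_fin ltW.
- move=> y y0; apply: (@continuous_comp _ _ _ (fun t => - t `^ x^-1) expR).
    by apply: continuousN; exact: continuous_powR.
  exact: continuous_expR.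
Qed.

Lemma measurable_Gamma_integrand (R : realType) (D : set R) (p : R) :
  measurable D -> measurable_fun D (fun t : R => (t `^ p * expR (- t))%:E).
Proof.
move=> mD; apply/measurable_EFinP.
apply: (@eq_measurable_fun _ _ _ _ _
  (fun t => t `^ p * expR (- (1 * t)))); first by move=> t _; rewrite mul1r.
exact: measurable_itv_powM_expRN.
Qed.

(** Between 1 and 2 the integrand is at most the sum of those at 1 and at 2;
    the functional equation does the rest, upwards and downwards. *)
Lemma eGamma_fin_num (R : realType) (x : R) : 0 < x -> eGamma x \is a fin_num.
Proof.
have G2 : eGamma 2 = 1%E :> \bar R.
  by rewrite -[2]/(1 + 1) eGammaS// mul1e eGamma1.
have base (y : R) : 1 <= y <= 2 -> eGamma y \is a fin_num.
  move=> /andP[y1 y2]; rewrite ge0_fin_numE ?eGamma_ge0//.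
  apply: (@le_lt_trans _ _ (eGamma (1 : R) + eGamma (2 : R))%E); last first.
    by rewrite G2 eGamma1 -EFinD ltry.
  rewrite /eGamma -ge0_integralD//.
  - apply: ge0_le_integral => //.
    + by move=> t _; rewrite lee_fin mulr_ge0 ?powR_ge0 ?expR_ge0.
    + exact: measurable_Gamma_integrand.
    + apply: emeasurable_funD; exact: measurable_Gamma_integrand.
    + move=> t; rewrite mem0y => t0; rewrite -EFinD lee_fin -mulrDl.
      rewrite ler_wpM2r ?expR_ge0// subrr powRr0 (_ : 2 - 1 = 1); last by ring.
      rewrite powRr1 ?(ltW t0)//.
      have [t1|t1] := leP 1 t.
        have H : t `^ (y - 1) <= t `^ 1 by apply: ler_powR => //; lra.
        by rewrite powRr1 ?(ltW t0)// in H; lra.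
      have H : t `^ (y - 1) <= t `^ 0 by apply: ger_powR; [rewrite t0 ltW|lra].
      by rewrite powRr0 in H; lra.
  - by move=> t _; rewrite lee_fin mulr_ge0 ?powR_ge0 ?expR_ge0.
  - exact: measurable_Gamma_integrand.
  - by move=> t _; rewrite lee_fin mulr_ge0 ?powR_ge0 ?expR_ge0.
  - exact: measurable_Gamma_integrand.
have step n (y : R) : 1 <= y <= n%:R + 1 -> eGamma y \is a fin_num.
  elim: n y => [|n IH] y.
    by move=> /andP[y1 y2]; apply: base; lra.
  move=> /andP[y1]; rewrite -natr1 => yn; have [y2|y2] := leP y 2.
    by apply: base; lra.
  rewrite -(subrK 1 y) eGammaS; last by lra.
  by rewrite fin_numM//; apply: IH; lra.
have big (y : R) : 1 <= y -> eGamma y \is a fin_num.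
  move=> y1; apply: (step (Num.bound y)); rewrite y1/=.
  have := archi_boundP (le_trans ler01 y1); lra.
move=> x0; have [/big//|x1] := leP 1 x.
have : eGamma (x + 1) \is a fin_num by apply: big; lra.
rewrite eGammaS//; apply: contraLR; rewrite ge0_fin_numE ?eGamma_ge0//.
rewrite -leNgt leye_eq => /eqP ->; by rewrite gt0_muley.
Qed.

Lemma eGammaE (R : realType) (x : R) : 0 < x -> eGamma x = (Gamma x)%:E.
Proof. by move=> x0; rewrite /Gamma /Rintegral fineK//; exact: eGamma_fin_num. Qed.

Lemma GammaS (R : realType) (x : R) : 0 < x -> Gamma (x + 1) = x * Gamma x.
Proof.
move=> x0; have := eGammaS x0; rewrite !eGammaE ?addr_gt0//.
by rewrite -EFinM => -[].
Qed.

Lemma Gamma_gt0 (R : realType) (x : R) : 0 < x -> 0 < Gamma x.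
Proof.
have big (y : R) : 1 <= y -> 0 < Gamma y.
  move=> y1; rewrite -lte_fin -eGammaE; last exact: lt_le_trans y1.
  apply: (@lt_le_trans _ _ (expR (- 2) : R)%:E); first by rewrite lte_fin expR_gt0.
  apply: (@le_trans _ _ (\int[lebesgue_measure]_(t in `]1%R, 2%R[) (expR (- 2) : R)%:E)%E).
    rewrite integral_cst//= lebesgue_measure_itv/= lte_fin ltr1n.
    by rewrite -EFinB (_ : 2 - 1 = 1) ?mule1//; ring.
  apply: (@le_trans _ _ (\int[lebesgue_measure]_(t in `]1%R, 2%R[) (t `^ (y - 1) * expR (- t))%:E)%E).
    apply: ge0_le_integral => //.
    - exact: measurable_Gamma_integrand.
    - move=> t /=; rewrite in_itv/= => /andP[t1 t2].
      rewrite lee_fin -[leLHS]mul1r ler_pM ?expR_ge0//.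
        have := @ler_powR _ t (ltW t1) 0 (y - 1); rewrite powRr0; apply; lra.
      by rewrite ler_expR lerN2 ltW.
  apply: ge0_subset_integral => //.
  - exact: measurable_Gamma_integrand.
  - by move=> t _; rewrite lee_fin mulr_ge0 ?powR_ge0 ?expR_ge0.
  - by move=> t /=; rewrite !in_itv/= andbT => /andP[t1 _]; exact: lt_trans t1.
move=> x0; have : 0 < Gamma (x + 1) by apply: big; lra.
by rewrite GammaS// pmulr_rgt0.
Qed.

Lemma integral_Gamma (R : realType) (x c : R) : 0 < x -> 0 < c ->
  (\int[lebesgue_measure]_(t in `]0%R, +oo[) (t `^ (x - 1) * expR (- (c * t)))%:E
   = (c `^ (- x) * Gamma x)%:E)%E.
Proof. by move=> x0 c0; rewrite eGamma_scale// eGammaE. Qed.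

(** The double integral of x^(a+b-1) r^(a-1) e^(-(1+r)x) is
    Gamma a * Gamma b in one order, and in the other Gamma (a+b) times the
    beta integral in the variable r = v / (1 - v). *)
Lemma integral_beta_kernel (R : realType) (a b : R) : 0 < a -> 0 < b ->
  (\int[lebesgue_measure]_(v in `]0%R, 1%R[) (beta_kernel a b v)%:E
   = (Gamma a * Gamma b / Gamma (a + b))%:E)%E.
Proof.
move=> a0 b0; have ab0 : 0 < a + b by rewrite addr_gt0.
pose h (x r : R) := x `^ (b + a - 1) * r `^ (a - 1) * expR (- ((1 + r) * x)).
have mh (f : R * R -> R * R) : measurable_fun setT f ->
    measurable_fun setT (fun z => h (f z).1 (f z).2).
  move=> mf.
  have m1 : measurable_fun setT (fun z => (f z).1) by exact: measurableT_comp.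
  have m2 : measurable_fun setT (fun z => (f z).2) by exact: measurableT_comp.
  apply: measurable_funM; first apply: measurable_funM.
  - exact: (measurableT_comp (measurable_powR _) m1).
  - exact: (measurableT_comp (measurable_powR _) m2).
  - apply: measurableT_comp => //; apply: measurableT_comp => //.
    by apply: measurable_funM => //; apply: measurable_funD.
have E1 : (\int[lebesgue_measure]_(x in `]0%R, +oo[)
    \int[lebesgue_measure]_(r in `]0%R, +oo[) (h x r)%:E = (Gamma a * Gamma b)%:E)%E.
  transitivity (\int[lebesgue_measure]_(x in `]0%R, +oo[)
      ((Gamma a)%:E * (x `^ (b - 1) * expR (- x))%:E))%E.
    apply: eq_integral => x; rewrite inE mem0y => x0.
    transitivity (\int[lebesgue_measure]_(r in `]0%R, +oo[)
        ((x `^ (b + a - 1) * expR (- x))%:E * (r `^ (a - 1) * expR (- (x * r)))%:E))%E.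
      apply: eq_integral => r; rewrite inE mem0y => r0.
      rewrite -EFinM; congr _%:E; rewrite /h mulrDl mul1r opprD expRD (mulrC r x); ring.
    rewrite ge0_integralZl//.
    - rewrite integral_Gamma// -!EFinM; congr _%:E.
      have -> : b + a - 1 = (b - 1) + a by ring.
      rewrite !(powR_expR _ x0) mulrDl expRD.
      have -> : expR ((b - 1) * ln x) * expR (a * ln x) * expR (- x) *
        (expR (- a * ln x) * Gamma a) = (expR (a * ln x) * expR (- a * ln x)) *
         (Gamma a * (expR ((b - 1) * ln x) * expR (- x))) by ring.
      by rewrite -expRD mulNr subrr expR0 mul1r.
    - by apply/measurable_EFinP; exact: measurable_itv_powM_expRN.
    - by move=> r _; rewrite lee_fin mulr_ge0 ?powR_ge0 ?expR_ge0.
    - by rewrite lee_fin mulr_ge0 ?powR_ge0 ?expR_ge0.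
  rewrite ge0_integralZl//.
  - by rewrite -/(eGamma b) eGammaE.
  - exact: measurable_Gamma_integrand.
  - by move=> r _; rewrite lee_fin mulr_ge0 ?powR_ge0 ?expR_ge0.
  - by rewrite lee_fin ltW ?Gamma_gt0.
have E2 : (\int[lebesgue_measure]_(r in `]0%R, +oo[)
    \int[lebesgue_measure]_(x in `]0%R, +oo[) (h x r)%:E =
    (Gamma (a + b))%:E * \int[lebesgue_measure]_(r in `]0%R, +oo[)
       (r `^ (a - 1) * (1 + r) `^ (- (a + b)))%:E)%E.
  rewrite -ge0_integralZl//.
  - apply: eq_integral => r; rewrite inE mem0y => r0.
    transitivity (\int[lebesgue_measure]_(x in `]0%R, +oo[)
        ((r `^ (a - 1))%:E * (x `^ (a + b - 1) * expR (- ((1 + r) * x)))%:E))%E.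
      apply: eq_integral => x _; rewrite -EFinM; congr _%:E; rewrite /h (addrC a b); ring.
    rewrite ge0_integralZl//.
    + by rewrite integral_Gamma// ?addr_gt0// -!EFinM; congr _%:E; ring.
    + by apply/measurable_EFinP; exact: measurable_itv_powM_expRN.
    + by move=> x _; rewrite lee_fin mulr_ge0 ?powR_ge0 ?expR_ge0.
    + by rewrite lee_fin powR_ge0.
  - apply/measurable_EFinP/measurable_funTS; apply: measurable_funM.
      exact: measurable_powR.
    by apply: (measurableT_comp (measurable_powR _)); exact: measurable_funD.
  - by move=> x _; rewrite lee_fin mulr_ge0 ?powR_ge0 ?expR_ge0.
  - by rewrite lee_fin ltW ?Gamma_gt0.
have E3 : (\int[lebesgue_measure]_(r in `]0%R, +oo[)
       (r `^ (a - 1) * (1 + r) `^ (- (a + b)))%:E =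
   \int[lebesgue_measure]_(v in `]0%R, 1%R[) (beta_kernel a b v)%:E)%E.
  transitivity (\int[lebesgue_measure]_(v in `]0%R, 1%R[)
    (((v / (1 - v)) `^ (a - 1) * (1 + v / (1 - v)) `^ (- (a + b))) * (1 - v) ^- 2)%:E)%E.
    apply: (@ge0_substitution_01 _ (fun v => v / (1 - v)) (fun v => (1 - v) ^- 2)
      (fun r => r `^ (a - 1) * (1 + r) `^ (- (a + b)))).
    - move=> x y x0 xy y1.
      have x'0 : 0 < 1 - x by lra.
      have y'0 : 0 < 1 - y by lra.
      by rewrite ltr_pdivrMr// mulrAC ltr_pdivlMr//; lra.
    - move=> x /andP[x0 x1].
      have x1' : 1 - x != 0 by rewrite subr_eq0 gt_eqF.
      apply: is_derive_eq; rewrite /GRing.scale/=; by field.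
    - move=> x /andP[x0 x1].
      have cb : {for x, continuous (fun v : R => 1 - v)}.
        by apply: continuousB; [exact: cst_continuous|exact: cvg_id].
      rewrite (_ : (fun v => _) = (fun v : R => ((1 - v) * (1 - v))^-1)); last first.
        by apply/funext => v; rewrite expr2.
      apply: continuousV; last exact: continuousM.
      by rewrite mulf_neq0// subr_eq0 gt_eqF.
    - by move=> x /andP[x0 x1]; rewrite invr_ge0 sqr_ge0.
    - by move=> x /andP[x0 x1]; rewrite divr_gt0// subr_gt0.
    - move=> y y0; exists (y / (1 + y)).
        rewrite divr_gt0 ?addr_gt0//= ltr_pdivrMr ?addr_gt0//; lra.
      by field; rewrite lt0r_neq0 ?addr_gt0//=; lra.
    - move=> y y0; apply: continuousM; first exact: continuous_powR.
      apply: (@continuous_comp _ _ _ (fun v : R => 1 + v) (fun z => z `^ (- (a + b)))).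
        by apply: continuousD; [exact: cst_continuous|exact: cvg_id].
      by apply: continuous_powR; rewrite addr_gt0.
    - by move=> y y0; rewrite mulr_ge0 ?powR_ge0.
  apply: eq_integral => v; rewrite inE/= in_itv/= => /andP[v0 v1].
  have v1' : 0 < 1 - v by rewrite subr_gt0.
  have -> : 1 + v / (1 - v) = (1 - v)^-1 by field; rewrite gt_eqF.
  congr _%:E; rewrite /beta_kernel !powR_expR ?divr_gt0 ?invr_gt0//.
  rewrite ln_div ?posrE// lnV ?posrE//.
  rewrite -[X in X ^- 2]lnK ?posrE// -expRM_natl -expRN -!expRD; congr expR; ring.
have mh2 : measurable_fun setT (fun z : R * R => h z.1 z.2) by exact: (mh id).
have := fubini_tonelli_on (measurable_itv `]0%R, +oo[) (measurable_itv `]0%R, +oo[)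
   (measurable_funTS mh2) (fun x y _ _ => mulr_ge0 (mulr_ge0 (powR_ge0 _ _) (powR_ge0 _ _)) (expR_ge0 _)).
rewrite E1 E2 E3 => H.
by rewrite EFinM H muleC muleA -EFinM mulVf ?mul1e// gt_eqF// Gamma_gt0.
Qed.

(** * Quotients of Gamma functions at infinity *)

Lemma powRS (R : realType) (x p : R) : 0 < x -> x `^ (p + 1) = x `^ p * x.
Proof.
move=> x0; rewrite powRD; last by rewrite (gt_eqF x0) implybT.
by rewrite powRr1// ltW.
Qed.

(** Young's inequality for the exponents 1/p and 1/(1-p), applied to r^p and
    1. *)
Lemma powR_le_tangent (R : realType) (p r : R) : 0 <= p <= 1 -> 0 < r ->
  r `^ p <= 1 + p * (r - 1).
Proof.
move=> /andP[]; rewrite le_eqVlt => /predU1P[<- _ _|p0].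
  by rewrite powRr0 mul0r addr0.
rewrite le_eqVlt => /predU1P[-> r0|p1 r0].
  by rewrite powRr1 ?(ltW r0)//; lra.
have q0 : 0 < 1 - p by lra.
have iq0 : 0 < (1 - p)^-1 by rewrite invr_gt0.
have ip0 : 0 < p^-1 by rewrite invr_gt0.
have pq1 : p^-1^-1 + (1 - p)^-1^-1 = 1 by rewrite !invrK; ring.
have := conjugate_powR (powR_ge0 r p) ler01 ip0 iq0 pq1.
have -> : (r `^ p) `^ p^-1 = r.
  by rewrite -powRrM mulfV ?gt_eqF// powRr1 // ltW.
have -> : 1 `^ (1 - p)^-1 = 1 :> R by rewrite powR1.
rewrite mulr1 !invrK mul1r => H.
by apply: (le_trans H); lra.
Qed.

(** Wendel's inequality.  The tangent of t^p at t = y lies above it, and the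
    integral of this tangent against the Gamma kernel of parameter y is
    y^p Gamma y, because that kernel has mean y. *)
Lemma Gamma_ratio_ub (R : realType) (y p : R) : 0 < y -> 0 <= p <= 1 ->
  Gamma (y + p) <= y `^ p * Gamma y.
Proof.
move=> y0 p01; have p0 : 0 <= p by case/andP: p01.
have p1 : p <= 1 by case/andP: p01.
rewrite -lee_fin -eGammaE; last by rewrite ltr_wpDr.
have -> : ((y `^ p * Gamma y)%:E = ((1 - p) * y `^ p)%:E * eGamma y +
    (p * y `^ (p - 1))%:E * eGamma (y + 1))%E.
  rewrite !eGammaE ?addr_gt0// GammaS// -!EFinM -EFinD; congr _%:E.
  have -> : y `^ p = y * y `^ (p - 1).
    by rewrite mulrC -powRS// subrK.
  ring.
rewrite /eGamma -!ge0_integralZl//; last 6 first.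
- exact: measurable_Gamma_integrand.
- by move=> t _; rewrite lee_fin mulr_ge0 ?powR_ge0 ?expR_ge0.
- by rewrite lee_fin mulr_ge0 ?powR_ge0.
- exact: measurable_Gamma_integrand.
- by move=> t _; rewrite lee_fin mulr_ge0 ?powR_ge0 ?expR_ge0.
- by rewrite lee_fin mulr_ge0 ?powR_ge0 ?subr_ge0.
rewrite -ge0_integralD//; last 4 first.
- move=> t _; rewrite mule_ge0// lee_fin mulr_ge0 ?powR_ge0 ?expR_ge0 ?subr_ge0//.
- by apply: measurable_funeM; exact: measurable_Gamma_integrand.
- by move=> t _; rewrite mule_ge0// lee_fin mulr_ge0 ?powR_ge0 ?expR_ge0.
- by apply: measurable_funeM; exact: measurable_Gamma_integrand.
apply: ge0_le_integral => //.
- by move=> t _; rewrite lee_fin mulr_ge0 ?powR_ge0 ?expR_ge0.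
- exact: measurable_Gamma_integrand.
- by apply: emeasurable_funD; apply: measurable_funeM; exact: measurable_Gamma_integrand.
move=> t; rewrite mem0y => t0.
rewrite -!EFinM -EFinD lee_fin !mulrA -mulrDl ler_wpM2r ?expR_ge0//.
have -> : t `^ (y + p - 1) = t `^ (y - 1) * (y `^ p * (t / y) `^ p).
  rewrite !powR_expR ?divr_gt0// ln_div ?posrE// -!expRD; congr expR; ring.
have -> : (1 - p) * y `^ p * t `^ (y - 1) + p * y `^ (p - 1) * t `^ (y + 1 - 1)
  = t `^ (y - 1) * (y `^ p * (1 + p * (t / y - 1))).
  have -> : t `^ (y + 1 - 1) = t `^ (y - 1) * t.
    by rewrite -powRS// addrAC.
  have -> : y `^ (p - 1) = y `^ p / y.
    by rewrite -[in RHS](subrK 1 p) powRS// mulfK// gt_eqF.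
  by field; rewrite gt_eqF.
rewrite ler_wpM2l ?powR_ge0// ler_wpM2l ?powR_ge0//.
by apply: powR_le_tangent => //; rewrite divr_gt0.
Qed.

(** The power is taken at [z], not at [z + q], so that quotients with different
    [q] and the same [z] combine into powers of [z]. *)
Definition Gamma_quot (R : realType) (z q : R) : R :=
  Gamma (z + q) / (z `^ q * Gamma z).

(** For q in [0, 1], [Gamma_ratio_ub] at z bounds the quotient above by 1, and
    at z + q with exponent 1 - q it bounds it below by z / (z + q).  Each unit
    step in q multiplies the quotient by 1 + (q - 1) / z. *)
Lemma Gamma_quot_near1 (R : realType) (q z0 : R) : 0 <= q -> 0 < z0 ->
  exists2 C, 0 <= C & forall z, z0 <= z -> `|Gamma_quot z q - 1| <= C / z.
Proof.
move=> + z00; have base p : 0 <= p <= 1 ->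
    exists2 C : R, 0 <= C & forall z, z0 <= z -> `|Gamma_quot z p - 1| <= C / z.
  move=> p01; have /andP[p0 p1] := p01.
  exists 1 => // z z0z; have zp : 0 < z by exact: lt_le_trans z0z.
  have zpp : 0 < z + p by rewrite ltr_wpDr.
  have Gz := Gamma_gt0 zp; have zpw := powR_gt0 p zp.
  have den : 0 < z `^ p * Gamma z by rewrite mulr_gt0.
  have ub : Gamma_quot z p <= 1.
    by rewrite /Gamma_quot ler_pdivrMr// mul1r Gamma_ratio_ub.
  have lb : z / (z + p) <= Gamma_quot z p.
    have p'01 : 0 <= 1 - p <= 1 by apply/andP; split; lra.
    have := Gamma_ratio_ub zpp p'01.
    rewrite (_ : z + p + (1 - p) = z + 1); last by ring.
    rewrite GammaS// => H. rewrite /Gamma_quot ler_pdivlMr//.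
    have zzp : (z / (z + p)) `^ (1 - p) * (z + p) `^ (1 - p) = z `^ (1 - p).
      by rewrite -powRM ?divfK ?gt_eqF ?divr_ge0 ?ltW.
    apply: (@le_trans _ _ ((z / (z + p)) `^ (1 - p) * (z `^ p * Gamma z))).
      rewrite ler_wpM2r ?(ltW den)//.
      have zz0 : 0 < z / (z + p) by rewrite divr_gt0.
      have zz1 : z / (z + p) <= 1 by rewrite ler_pdivrMr// mul1r lerDl.
      rewrite -[leLHS]powRr1 ?(ltW zz0)//.
      by apply: ger_powR; [rewrite zz0|lra].
    have zE : z `^ (1 - p) * z `^ p = z.
      by rewrite -powRD ?subrK ?powRr1 ?ltW// oner_eq0.
    rewrite -(ler_pM2r (powR_gt0 (1 - p) zpp)).
    rewrite (_ : _ * _ * _ = (z `^ (1 - p) * z `^ p) * Gamma z); last first.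
      by rewrite -zzp; ring.
    by rewrite zE [leRHS]mulrC.
  have lb' : 1 - 1 / z <= z / (z + p).
    have pz : 0 <= p / z by rewrite divr_ge0// ltW.
    have E : (1 - 1 / z) * (z + p) = z - (1 - p) - p / z by field; rewrite gt_eqF.
    by rewrite ler_pdivlMr// E; lra.
  rewrite ler_norml; apply/andP; split; last first.
    by apply: (@le_trans _ _ 0); [lra|rewrite divr_ge0// ltW].
  lra.
have step n s : 0 <= s <= n%:R + 1 ->
    exists2 C : R, 0 <= C & forall z, z0 <= z -> `|Gamma_quot z s - 1| <= C / z.
  elim: n s => [|n IH] s.
    by rewrite add0r; exact: base.
  move=> /andP[s0]; rewrite -natr1 => sn; have [s1|s1] := leP s 1.
    by apply: base; rewrite s0 s1.
  have [|C C0 HC] := IH (s - 1); first by apply/andP; split; lra.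
  exists (C + (s - 1) * (1 + C / z0)).
    have cz : 0 <= C / z0 by rewrite divr_ge0// ltW.
    by rewrite addr_ge0// mulr_ge0//; lra.
  move=> z z0z; have zp : 0 < z by exact: lt_le_trans z0z.
  have s1' : 0 < z + (s - 1) by lra.
  have -> : Gamma_quot z s = (1 + (s - 1) / z) * Gamma_quot z (s - 1).
    rewrite /Gamma_quot (_ : z + s = z + (s - 1) + 1); last by ring.
    rewrite GammaS// (_ : z `^ s = z `^ (s - 1) * z).
      by field; rewrite !gt_eqF ?Gamma_gt0 ?powR_gt0.
    by rewrite -powRS// subrK.
  set g := Gamma_quot z (s - 1) in HC *.
  have Hg := HC _ z0z; rewrite -/g in Hg.
  have -> : (1 + (s - 1) / z) * g - 1 = (g - 1) + (s - 1) / z * g by ring.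
  have -> : (C + (s - 1) * (1 + C / z0)) / z = C / z + (s - 1) / z * (1 + C / z0).
    by ring.
  have sz0 : 0 <= (s - 1) / z by rewrite divr_ge0// ?(ltW zp)//; lra.
  apply: (le_trans (ler_normD _ _)); rewrite lerD//.
  rewrite normrM (ger0_norm sz0) ler_wpM2l//.
  have -> : g = 1 + (g - 1) by ring.
  apply: (le_trans (ler_normD _ _)); rewrite normr1 lerD2l (le_trans Hg)//.
  by rewrite ler_wpM2l// lef_pV2 ?posrE.
move=> q0; apply: (step (Num.bound q)); rewrite q0/=.
by have := archi_boundP q0; lra.
Qed.

(** * Negative moments of the positive stable law *)

Section stable_moment.
Variables (R : realType) (alpha : R) (f : R -> R).
Hypotheses (alpha0 : 0 < alpha) (alpha1 : alpha < 1).
Variable mu : probability R R.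
Hypothesis muf : has_density_on mu `]0, +oo[ f.
Hypothesis laplace : forall s : R, 0 <= s ->
  (\int[mu]_x (expR (- (s * x)))%:E = (expR (- (s `^ alpha)))%:E)%E.

Local Notation D := (`]0%R, +oo[%classic : set R).

Let laplace_on (s : R) : 0 <= s ->
  (\int[mu]_(x in D) (expR (- (s * x)))%:E = (expR (- (s `^ alpha)))%:E)%E.
Proof.
move=> s0; rewrite -laplace//.
have me : measurable_fun setT (fun x : R => (expR (- (s * x)))%:E).
  apply/measurable_EFinP; apply: continuous_measurable_fun => x.
  exact: continuous_expRN.
have mD : measurable (~` D) by apply: measurableC.
have muD : mu (~` D) = 0%E by case: muf => _ _ ->//; rewrite setICl integral_set0.
rewrite [RHS](@ge0_negligible_integral _ _ _ mu setT (~` D)) //.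
  by rewrite setTD setCK.
Qed.

Let deriv_exp (y s : R) :
  is_derive s 1 (fun x => expR (- (x * y))) (- (y * expR (- (s * y)))).
Proof. apply: is_derive_eq; rewrite /GRing.scale/=; ring. Qed.

Let bound_exp (s y : R) : 0 < s -> 0 < y -> y * expR (- (s * y)) <= s^-1.
Proof.
move=> s0 y0; rewrite expRN ler_pdivrMr ?expR_gt0//.
rewrite mulrC ler_pdivlMr// mulrC; apply: le_trans (expR_ge1Dx _).
by rewrite lerDr.
Qed.

(** Differentiation of the Laplace transform under the integral sign; near s
    the derivative of the integrand is dominated by 2 / s. *)
Lemma stable_laplace_deriv (s : R) : 0 < s ->
  (\int[mu]_(x in D) (x * expR (- (s * x)))%:E =
   (alpha * s `^ (alpha - 1) * expR (- (s `^ alpha)))%:E)%E.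
Proof.
move=> s0.
have mD : measurable D by [].
have me (c : R) (E : set R) : measurable_fun E (fun x : R => expR (- (c * x))).
  by apply: measurable_funTS; apply: continuous_measurable_fun => x; exact: continuous_expRN.
have Is : `](s / 2), (s * 2)[%classic s by rewrite /= in_itv/=; apply/andP; split; lra.
have intf (x : R) : `](s / 2), (s * 2)[%classic x ->
    mu.-integrable D (EFin \o (fun y : R => expR (- (x * y)))).
  rewrite /= in_itv/= => /andP[x0 _].
  apply: (@bounded_integrable _ _ _ mu _ _ 1) => // y; rewrite mem0y => y0.
  rewrite ger0_norm ?expR_ge0// -expR0 ler_expR oppr_le0 mulr_ge0 ?(ltW y0)//; lra.
have derf (x y : R) : `](s / 2), (s * 2)[%classic x -> D y ->
   derivable (fun x : R => expR (- (x * y))) x 1.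
  by move=> _ _; case: (deriv_exp y x).
have d1E (x y : R) : partial1of2 (fun x y : R => expR (- (x * y))) x y =
   - (y * expR (- (x * y))).
  by rewrite partial1of2E; case: (deriv_exp y x).
have G0 (y : R) : 0 <= (cst (s / 2)^-1) y by rewrite /= invr_ge0; lra.
have intG : mu.-integrable D (EFin \o cst (s / 2)^-1).
  apply: (@bounded_integrable _ _ _ mu _ _ (s / 2)^-1) => // y _.
  by rewrite ger0_norm.
have Gub (x y : R) : `](s / 2), (s * 2)[%classic x -> D y ->
    `|partial1of2 (fun x y : R => expR (- (x * y))) x y| <= (cst (s / 2)^-1) y.
  move=> + yD; rewrite /= in_itv/= => /andP[x0 _]; move: yD; rewrite mem0y => y0.
  rewrite d1E normrN ger0_norm; last by rewrite mulr_ge0 ?expR_ge0 ?ltW.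
  have xp : 0 < x by lra.
  by apply: (le_trans (bound_exp xp y0)); rewrite lef_pV2 ?posrE//; lra.
have := @differentiation_under_integral R _ _ mu (fun x y : R => expR (- (x * y)))
  D mD s _ _ Is intf derf _ G0 intG Gub.
have -> : (fun x' => \int[mu]_(y in D) expR (- (x' * y)))^`()%classic s =
   - (alpha * s `^ (alpha - 1) * expR (- (s `^ alpha))).
  rewrite derive1E.
  rewrite (@near_eq_derive _ _ _ _ (fun x : R => expR (- (x `^ alpha)))).
  - have := is_derive1_powR alpha s0 => H.
    have : is_derive s 1 (fun x : R => expR (- x `^ alpha))
       (- (alpha * s `^ (alpha - 1) * expR (- s `^ alpha))).
      apply: is_derive_eq; rewrite /GRing.scale/=; ring.
    by case.
  - near=> x; rewrite /Rintegral laplace_on//.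
    by apply/ltW; near: x; exact: lt_nbhsr.
under [X in _ = X -> _]eq_Rintegral do rewrite d1E.
have int2 : mu.-integrable D (EFin \o (fun y : R => y * expR (- (s * y)))).
  apply: (@bounded_integrable _ _ _ mu _ _ s^-1) => //.
    by apply: measurable_funM.
  move=> y; rewrite mem0y => y0; rewrite ger0_norm ?bound_exp//.
  by rewrite mulr_ge0 ?expR_ge0 ?ltW.
move=> H; rewrite -[LHS]fineK; last exact: integrable_fin_num.
congr _%:E; apply: oppr_inj; rewrite H.
rewrite /Rintegral -fineN -integralN//=.
exact: integrable_add_def.
Unshelve. all: by end_near. Qed.

(** The double integral of s^p S e^(-sS) over s > 0 and over the law of S, in
    both orders.  Starting from E(S e^(-sS)) instead of E(e^(-sS)) gains one
    power of s at the origin, hence the range p > - alpha, which contains 0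
    and negative orders. *)
Lemma stable_moment_of_law (p : R) : - alpha < p ->
  (\int[lebesgue_measure]_(t in D) (t `^ (- p) * f t)%:E =
   (Gamma (p / alpha + 1) / Gamma (p + 1))%:E)%E.
Proof.
move=> pa; have p1 : 0 < p + 1 by rewrite -ltrBlDr sub0r (lt_trans _ pa)// ltrN2.
have q1 : 0 < p / alpha + 1.
  by rewrite -ltrBlDr sub0r ltr_pdivlMr// mulN1r.
case: (muf) => mf f0 _.
pose h (s y : R) := s `^ p * (y * expR (- (s * y)) * f y).
have E1 : (\int[lebesgue_measure]_(s in D) \int[lebesgue_measure]_(y in D) (h s y)%:E
    = (Gamma (p / alpha + 1))%:E)%E.
  rewrite -eGammaE// /eGamma.
  rewrite (@integral_powR_subst _ alpha (fun u => u `^ (p / alpha + 1 - 1) * expR (- u)))//.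
  - apply: eq_integral => s; rewrite inE mem0y => s0.
    transitivity ((s `^ p)%:E * \int[mu]_(x in D) (x * expR (- (s * x)))%:E)%E.
      rewrite [in RHS]integral_mkcond.
      transitivity ((s `^ p)%:E * \int[mu]_x (((fun x => x * expR (- (s * x))) \_ D) x)%:E)%E; last first.
        by congr (_ * _)%E; apply: eq_integral => x _; rewrite !patchE; case: ifP.
      rewrite (ge0_integral_density _ muf)//.
      - rewrite -ge0_integralZl//.
        + apply: eq_integral => y yD; rewrite -EFinM; congr _%:E.
          by rewrite patchE yD /h.
        + apply/measurable_EFinP; apply: measurable_funM => //.
          apply: measurable_funTS; apply/(measurable_restrictT _ _).1 => //.
          apply: measurable_funM => //; apply: measurable_funTS.
          by apply: continuous_measurable_fun => x; exact: continuous_expRN.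
        + move=> y yD; rewrite lee_fin mulr_ge0 ?f0// patchE mem_set//.
          move: yD; rewrite mem0y => y0.
          by rewrite mulr_ge0 ?expR_ge0 ?ltW.
        + by rewrite lee_fin powR_ge0.
      - apply/(measurable_restrictT _ _).1 => //.
        apply: measurable_funM => //; apply: measurable_funTS.
        by apply: continuous_measurable_fun => x; exact: continuous_expRN.
      - move=> y; rewrite patchE; case: ifPn => //.
        by rewrite inE mem0y => y0; rewrite mulr_ge0 ?expR_ge0 ?ltW.
    rewrite stable_laplace_deriv// -EFinM; congr _%:E.
    have -> : (s `^ alpha) `^ (p / alpha + 1 - 1) = s `^ p.
      by rewrite addrK -powRrM mulrCA mulfV ?gt_eqF// mulr1.
    ring.
  - by move=> y; exact: continuous_Gamma_integrand.
  - by move=> y _; rewrite mulr_ge0 ?powR_ge0 ?expR_ge0.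
have E2 : (\int[lebesgue_measure]_(y in D) \int[lebesgue_measure]_(s in D) (h s y)%:E
    = (Gamma (p + 1))%:E * \int[lebesgue_measure]_(t in D) (t `^ (- p) * f t)%:E)%E.
  rewrite -ge0_integralZl//.
  - apply: eq_integral => y; rewrite inE mem0y => y0.
    transitivity (\int[lebesgue_measure]_(s in D)
        ((y * f y)%:E * (s `^ (p + 1 - 1) * expR (- (y * s)))%:E))%E.
      apply: eq_integral => s _; rewrite -EFinM; congr _%:E.
      rewrite /h addrK (mulrC s y); ring.
    have fy : 0 <= f y by apply: f0; rewrite mem0y.
    rewrite ge0_integralZl//.
    + rewrite integral_Gamma// -!EFinM; congr _%:E.
      have -> : y `^ (- p) = y `^ (- (p + 1)) * y by rewrite -powRS//; congr (_ `^ _); ring.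
      ring.
    + by apply/measurable_EFinP; exact: measurable_itv_powM_expRN.
    + by move=> x _; rewrite lee_fin mulr_ge0 ?powR_ge0 ?expR_ge0.
    + by rewrite lee_fin mulr_ge0 // ltW.
  - apply/measurable_EFinP; apply: measurable_funM => //.
    by apply: measurable_funTS; exact: measurable_powR.
  - by move=> t /f0 ft; rewrite lee_fin mulr_ge0 ?powR_ge0.
  - by rewrite lee_fin ltW ?Gamma_gt0.
have mh : measurable_fun (D `*` D) (fun z : R * R => h z.1 z.2).
  have mfD : measurable_fun setT (f \_ D).
    by apply/(measurable_restrictT _ _).1 => //.
  apply: (@eq_measurable_fun _ _ _ _ _ (fun z : R * R =>
      z.1 `^ p * (z.2 * expR (- (z.1 * z.2)) * (f \_ D) z.2))).
    by move=> z /set_mem[_ z2]; rewrite /h patchE (mem_set z2).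
  apply: measurable_funTS; apply: measurable_funM.
    exact: (measurableT_comp (measurable_powR p) measurable_fst).
  apply: measurable_funM; last exact: (measurableT_comp mfD measurable_snd).
  apply: measurable_funM; first exact: measurable_snd.
  apply: measurableT_comp => //; apply: measurableT_comp => //.
  by apply: measurable_funM; [exact: measurable_fst|exact: measurable_snd].
have hpos x y : D x -> D y -> 0 <= h x y.
  rewrite !mem0y => x0 y0; rewrite /h mulr_ge0 ?powR_ge0//.
  by rewrite !mulr_ge0 ?expR_ge0 ?(ltW y0)// f0// mem0y.
have := fubini_tonelli_on (measurable_itv `]0%R, +oo[) (measurable_itv `]0%R, +oo[) mh hpos.
rewrite E1 E2.
have Gp := Gamma_gt0 p1.
case: (\int[lebesgue_measure]_(t in D) (t `^ (- p) * f t)%:E)%E => [r||].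
- by rewrite -EFinM => -[->]; congr _%:E; rewrite mulrAC mulfV ?mul1r// gt_eqF.
- by rewrite gt0_muley ?lte_fin.
- by rewrite gt0_muleNy ?lte_fin.
Qed.

End stable_moment.

Lemma stable_moment (R : realType) (alpha : R) (f : R -> R) (p : R) :
  0 < alpha -> alpha < 1 -> is_positive_stable_density alpha f ->
  - alpha < p ->
  (\int[lebesgue_measure]_(t in `]0%R, +oo[) (t `^ (- p) * f t)%:E =
   (Gamma (p / alpha + 1) / Gamma (p + 1))%:E)%E.
Proof.
move=> a0 a1 [mu [muf lap]] pa.
(* The identity carries the law from one copy of the Borel line to another. *)
pose idR : measurableTypeR R -> R := idfun.
have midR : measurable_fun setT idR by exact: measurable_id.
pose X : {RV mu >-> R} := HB.pack idR (isMeasurableFun.Build _ _ _ _ idR midR).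
apply: (@stable_moment_of_law _ alpha f a0 a1 (distribution mu X)) => //.
move=> s s0; rewrite ge0_integral_distribution/=.
- by rewrite -lap// unlock.
- apply/measurable_EFinP; apply: continuous_measurable_fun => x.
  exact: continuous_expRN.
- by move=> x; rewrite lee_fin expR_ge0.
Qed.

(** * Independence and the transform of the renewal epochs *)

Section independence.
Context d (Omega : measurableType d) (R : realType) (P : probability Omega R).
Variable V : nat -> {RV P >-> R}.
Hypothesis indepV : independent_RVs V.

Let mpre (i : nat) (A : set R) : measurable A -> measurable (V i @^-1` A).
Proof. by move=> mA; rewrite -[X in measurable X]setTI; exact: measurable_funP. Qed.

Let indE (i : nat) (A : set R) : measurable A ->
  (\int[P]_w (\1_A (V i w))%:E = P (V i @^-1` A))%E.
Proof.
move=> mA; transitivity (\int[P]_w (\1_(V i @^-1` A) w)%:E)%E.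
  by apply: eq_integral => w _; rewrite !indicE; congr (_%:R%:E).
by rewrite integral_indic ?setIT//; exact: mpre.
Qed.

Let indfin (i : nat) (A : set R) : measurable A ->
  (\int[P]_w (\1_A (V i w))%:E \is a fin_num)%E.
Proof. by move=> mA; rewrite indE// fin_num_measure//; exact: mpre. Qed.

Let indep_indic (N : nat) (A : nat -> set R) :
  (forall i, measurable (A i)) ->
  (\int[P]_w (\prod_(i < N) \1_(A i) (V i w))%:E =
   \prod_(i < N) \int[P]_w (\1_(A i) (V i w))%:E)%E.
Proof.
move=> mA; pose J : {fset nat} := [fset i in iota 0 N]%fset.
have JP i : (i \in J) = (i < N)%N by rewrite !inE mem_iota.
have mV i : measurable (V i @^-1` A i) by exact: mpre.
have -> : (\int[P]_w (\prod_(i < N) \1_(A i) (V i w))%:E =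
    P (\bigcap_(j in [set` J]) (V j @^-1` A j)))%E.
  have mI : measurable (\bigcap_(j in [set` J]) (V j @^-1` A j)).
    by apply: fin_bigcap_measurable => //; exact: finite_fset.
  transitivity (\int[P]_w (\1_(\bigcap_(j in [set` J]) (V j @^-1` A j)) w)%:E)%E;
    last by rewrite integral_indic// setIT.
  apply: eq_integral => w _; congr _%:E; rewrite [RHS]indicE.
  have [wI|wI] := boolP (w \in _).
    rewrite big1// => i _; rewrite indicE mem_set//.
    by move: wI; rewrite inE => /(_ i); apply; rewrite /= JP.
  move: wI; rewrite notin_setE => wI.
  have [i [iN nA]] : exists i : nat, (i < N)%N /\ ~ A i (V i w).
    apply/not_existsP => H; apply: wI => i /=; rewrite JP => iN.
    by apply: contrapT => nA; exact: (H i).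
  by rewrite (bigD1 (Ordinal iN))//= indicE memNset// mul0r.
rewrite indepV//; under [RHS]eq_bigr do rewrite indE//.
rewrite -(big_mkord xpredT (fun i => P (V i @^-1` A i))) /index_iota subn0.
apply: perm_big; apply: uniq_perm; rewrite ?fset_uniq ?iota_uniq// => i.
by rewrite JP mem_iota.
Qed.

(** The induction hypothesis of the product formula: all factors beyond the
    first [n] are still indicators, as in the definition of independence. *)
Definition expectation_prod_first (n : nat) := forall (N : nat) (h : nat -> R -> R),
  (forall i, measurable_fun setT (h i)) -> (forall i x, 0 <= h i x) ->
  (forall i, \int[P]_w (h i (V i w))%:E \is a fin_num)%E ->
  (forall i, (n <= i)%N -> exists2 A, measurable A & h i = \1_A) ->
  (\int[P]_w (\prod_(i < N) h i (V i w))%:E =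
   \prod_(i < N) \int[P]_w (h i (V i w))%:E)%E.

Let expectation_prod_indic : expectation_prod_first 0.
Proof.
move=> N h mh h0 hfin hA.
have /choice[A AP] : forall i, exists A, measurable A /\ h i = \1_A.
  by move=> i; have [A mA ->] := hA i (leq0n i); exists A.
under eq_integral do under eq_bigr => i _ do rewrite (AP i).2.
under [RHS]eq_bigr => i _ do under eq_integral do rewrite (AP i).2.
by apply: indep_indic => i; exact: (AP i).1.
Qed.

Let expectation_prod_step n : expectation_prod_first n -> expectation_prod_first n.+1.
Proof.
move=> IH N h mh h0 hfin hA.
have [nN|Nn] := ltnP n N; last first.
  pose h' i := if (i < N)%N then h i else \1_setT.
  have h'E i : (i < N)%N -> h' i = h i by rewrite /h' => ->.
  under eq_integral do under eq_bigr => i _ do rewrite -(h'E i (ltn_ord i)).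
  under [RHS]eq_bigr => i _ do rewrite -(h'E i (ltn_ord i)).
  apply: IH.
  - by move=> i; rewrite /h'; case: ifP.
  - by move=> i x; rewrite /h'; case: ifP.
  - by move=> i; rewrite /h'; case: ifP => // _; exact: indfin.
  - move=> i ni; rewrite /h' ltnNge (leq_trans Nn ni)/=.
    by exists setT.
pose n' := Ordinal nN.
pose c := (\prod_(i < N | i != n') \int[P]_w (h i (V i w))%:E)%E.
have cfin : c \is a fin_num by apply: prode_fin_num => i _; exact: hfin.
have c0 : (0 <= c)%E.
  by apply: prode_ge0 => i _; apply: integral_ge0 => w _; rewrite lee_fin.
pose F w := \prod_(i < N | i != n') h i (V i w).
have mF : measurable_fun setT F.
  rewrite (_ : F = fun w => \prod_(i < N) (if i != n' then h i (V i w) else 1)); last first.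
    by apply/funext => w; rewrite /F big_mkcond.
  apply: measurable_prod => i _; case: (i != n') => //.
  exact: measurableT_comp.
rewrite [RHS](bigD1 (n' : 'I_N))//= -/c.
have -> : (\int[P]_w (h n (V n w))%:E = \int[distribution P (V n)]_x (h n x)%:E)%E.
  rewrite ge0_integral_distribution//.
  - exact/measurable_EFinP.
  - by move=> x; rewrite lee_fin.
(* The other factors, with value [c] once integrated, weight the law of V n. *)
rewrite muleC -(fineK cfin).
rewrite -(@ge0_integral_weighted_law _ _ _ _ _ P _ F (V n))//.
- by apply: eq_integral => w _; rewrite (bigD1 n')//= mulrC.
- by move=> w; apply: prodr_ge0.
- exact: fine_ge0.
- move=> A mA; rewrite fineK//.
  pose h' i := if i == n then \1_A else h i.
  have h'n : h' n = \1_A by rewrite /h' eqxx.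
  have h'i (i : 'I_N) : i != n' -> h' i = h i.
    by rewrite -val_eqE/= /h' => /negbTE ->.
  transitivity (\int[P]_w (\prod_(i < N) h' i (V i w))%:E)%E.
    apply: eq_integral => w _; rewrite (bigD1 n')//= h'n mulrC; congr (_ * _)%:E.
    by apply: eq_bigr => i /h'i ->.
  rewrite IH.
  + rewrite (bigD1 n')//= h'n indE// muleC; congr (_ * _)%E.
    by apply: eq_bigr => i /h'i ->.
  + by move=> i; rewrite /h'; case: ifP.
  + by move=> i x; rewrite /h'; case: ifP.
  + by move=> i; rewrite /h'; case: ifP => // _; exact: indfin.
  + move=> i ni; rewrite /h'; case: eqP => [_|/eqP in']; first by exists A.
    by apply: hA; rewrite ltn_neqAle eq_sym in'.
Qed.

Lemma expectation_prod (N : nat) (h : nat -> R -> R) :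
  (forall i, measurable_fun setT (h i)) -> (forall i x, 0 <= h i x) ->
  (forall i, \int[P]_w (h i (V i w))%:E \is a fin_num)%E ->
  (\int[P]_w (\prod_(i < N) h i (V i w))%:E =
   \prod_(i < N) \int[P]_w (h i (V i w))%:E)%E.
Proof.
move=> mh h0 hfin; have expectN n : expectation_prod_first n.
  by elim: n => [|n]; [exact: expectation_prod_indic|exact: expectation_prod_step].
pose h' i := if (i < N)%N then h i else \1_setT.
have h'E i : (i < N)%N -> h' i = h i by rewrite /h' => ->.
under eq_integral do under eq_bigr => i _ do rewrite -(h'E i (ltn_ord i)).
under [RHS]eq_bigr => i _ do rewrite -(h'E i (ltn_ord i)).
apply: (expectN N).
- by move=> i; rewrite /h'; case: ifP.
- by move=> i x; rewrite /h'; case: ifP.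
- by move=> i; rewrite /h'; case: ifP => // _; exact: indfin.
- move=> i ni; rewrite /h' ltnNge ni/=.
  by exists setT.
Qed.

End independence.

Section beta_moment.
Context d (Omega : measurableType d) (R : realType) (P : probability Omega R).

(** Weighting by (1 - v)^s turns the kernel of parameters (a, b) into that of
    parameters (a, b + s). *)
Lemma beta_log_moment (a b s : R) (X : {RV P >-> R}) :
  0 < a -> 0 < b -> 0 <= s -> is_beta a b X ->
  (\int[P]_w (expR (s * ln (1 - X w)))%:E =
   (Gamma (b + s) * Gamma (a + b) / (Gamma b * Gamma (a + (b + s))))%:E)%E.
Proof.
move=> a0 b0 s0 Xb; have bs0 : 0 < b + s by rewrite ltr_wpDr.
have mln : measurable_fun setT (fun x : R => expR (s * ln (1 - x))).
  apply: measurableT_comp => //; apply: measurable_funM => //.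
  by apply: measurableT_comp => //; exact: measurable_funB.
have -> : (\int[P]_w (expR (s * ln (1 - X w)))%:E =
    \int[distribution P X]_x (expR (s * ln (1 - x)))%:E)%E.
  by rewrite ge0_integral_distribution//; exact/measurable_EFinP.
rewrite (ge0_integral_density _ Xb)//.
have Gpos := (Gamma_gt0 a0, Gamma_gt0 b0, Gamma_gt0 bs0,
  Gamma_gt0 (addr_gt0 a0 b0), Gamma_gt0 (addr_gt0 a0 bs0)).
have BE : \int[lebesgue_measure]_(u in `]0, 1[) beta_kernel a b u =
    Gamma a * Gamma b / Gamma (a + b).
  by rewrite /Rintegral integral_beta_kernel.
transitivity (\int[lebesgue_measure]_(x in `]0%R, 1%R[)
    (((Gamma a * Gamma b / Gamma (a + b))^-1)%:E * (beta_kernel a (b + s) x)%:E))%E.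
  apply: eq_integral => x; rewrite inE/= in_itv/= => /andP[x0 x1].
  rewrite -EFinM; congr _%:E; rewrite /beta_density BE /beta_kernel.
  have x'0 : 0 < 1 - x by rewrite subr_gt0.
  have -> : (1 - x) `^ (b + s - 1) = (1 - x) `^ (b - 1) * expR (s * ln (1 - x)).
    by rewrite !powR_expR// -expRD; congr expR; ring.
  ring.
have mk : measurable_fun (`]0%R, 1%R[%classic : set R) (beta_kernel a (b + s)).
  apply: measurable_funTS; apply: measurable_funM; first exact: measurable_powR.
  by apply: (measurableT_comp (measurable_powR _)); exact: measurable_funB.
rewrite ge0_integralZl//.
- rewrite integral_beta_kernel// -EFinM; congr _%:E.
  move: (Gamma a) (Gamma b) (Gamma (b + s)) (Gamma (a + b)) (Gamma (a + (b + s))) Gpos.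
  by move=> ga gb gc gd ge [[[[? ?] ?] ?] ?]; field; rewrite !gt_eqF.
- exact/measurable_EFinP.
- by move=> x _; rewrite lee_fin mulr_ge0 ?powR_ge0.
- rewrite lee_fin invr_ge0 divr_ge0 ?mulr_ge0// ltW//.
  + exact: Gamma_gt0.
  + exact: Gamma_gt0.
  + by apply: Gamma_gt0; rewrite addr_gt0.
Qed.

End beta_moment.

(** E S^(-p) for S positive stable of exponent [alpha], by [stable_moment]. *)
Definition stable_mellin (R : realType) (alpha p : R) : R :=
  Gamma (p / alpha + 1) / Gamma (p + 1).

Lemma stable_arg_gt0 (R : realType) (alpha p : R) : 0 < alpha -> - alpha < p ->
  0 < p / alpha + 1.
Proof. by move=> a0 pa; rewrite -ltrBlDr sub0r ltr_pdivlMr// mulN1r. Qed.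

Lemma stable_mellin_gt0 (R : realType) (alpha p : R) : 0 < alpha ->
  alpha < 1 -> - alpha < p -> 0 < stable_mellin alpha p.
Proof.
move=> a0 a1 pa; rewrite divr_gt0 ?Gamma_gt0 ?stable_arg_gt0//; lra.
Qed.

(** The left-hand side is the moment of order s of 1 - V for V of law
    beta(1 - alpha, b + alpha).  Written through [stable_mellin] at b and at
    b + alpha, it telescopes when b runs through theta + j alpha. *)
Lemma stable_mellin_ratio (R : realType) (alpha b s : R) :
  0 < alpha -> alpha < 1 -> - alpha < b -> 0 <= s ->
  Gamma (b + alpha + s) * Gamma (1 - alpha + (b + alpha)) /
    (Gamma (b + alpha) * Gamma (1 - alpha + (b + alpha + s))) =
  (stable_mellin alpha (b + s) / stable_mellin alpha (b + alpha + s)) *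
  (stable_mellin alpha (b + alpha) / stable_mellin alpha b).
Proof.
move=> a0 a1 ba s0; rewrite /stable_mellin.
move: (@GammaS R) (@Gamma_gt0 R); move: (@Gamma R) => G GS G_gt0.
have bsa : - alpha < b + s by lra.
have E (p : R) : - alpha < p ->
    G ((p + alpha) / alpha + 1) / G (p + alpha + 1) =
    (p / alpha + 1) * G (p / alpha + 1) / ((p + alpha) * G (p + alpha)).
  move=> pa; rewrite -(GS _ (stable_arg_gt0 a0 pa)).
  rewrite (_ : (p + alpha) / alpha = p / alpha + 1); last by rewrite mulrDl mulfV ?gt_eqF.
  by rewrite (GS (p + alpha))//; lra.
have E1 := E _ ba; have E2 := E _ bsa.
rewrite (_ : b + alpha + s = (b + s) + alpha); last by ring.
rewrite E1 E2 (_ : 1 - alpha + (b + alpha) = b + 1); last by ring.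
rewrite (_ : 1 - alpha + (b + s + alpha) = b + s + 1); last by ring.
have q1 := stable_arg_gt0 a0 ba.
have q2 := stable_arg_gt0 a0 bsa.
have G1 := G_gt0 _ q1.
have G2 := G_gt0 _ q2.
have G3 : 0 < G (b + 1) by apply: G_gt0; lra.
have G4 : 0 < G (b + s + 1) by apply: G_gt0; lra.
have G5 : 0 < G (b + alpha) by apply: G_gt0; lra.
have G6 : 0 < G (b + s + alpha) by apply: G_gt0; lra.
have n1 : b + alpha != 0 by rewrite gt_eqF//; lra.
have n2 : b + s + alpha != 0 by rewrite gt_eqF//; lra.
have r1 : b / alpha + 1 = (b + alpha) / alpha by field; rewrite gt_eqF.
have r2 : (b + s) / alpha + 1 = (b + s + alpha) / alpha.
  by field; rewrite gt_eqF.
rewrite r1 r2 in G1 G2 *.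
by field; rewrite n1 n2 !gt_eqF.
Qed.

Section renewal_moment.
Context d (Omega : measurableType d) (R : realType) (P : probability Omega R).
Variables (alpha theta : R) (V : nat -> {RV P >-> R}).
Hypotheses (a0 : 0 < alpha) (a1 : alpha < 1) (ta : - alpha < theta).
Hypothesis indepV : independent_RVs V.
Hypothesis betaV : forall j : nat,
  is_beta (1 - alpha) (theta + j.+1%:R * alpha) (V j).

Let m (s : R) (n : nat) := stable_mellin alpha (theta + n%:R * alpha + s).

Lemma factor_moment (s : R) (j : nat) : 0 <= s ->
  (\int[P]_w (expR (s * ln (1 - V j w)))%:E =
   ((m s j / m s j.+1) * (m 0 j.+1 / m 0 j))%:E)%E.
Proof.
move=> s0; rewrite (beta_log_moment _ _ s0 (betaV j)); last 2 first.
- by rewrite subr_gt0.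
- rewrite -natr1 mulrDl mul1r addrA.
  have : 0 <= j%:R * alpha by rewrite mulr_ge0// ltW.
  move: ta; lra.
congr _%:E; rewrite /m !addr0.
have ja : 0 <= j%:R * alpha by rewrite mulr_ge0// ltW.
have -> : theta + j.+1%:R * alpha = theta + j%:R * alpha + alpha.
  by rewrite -natr1; ring.
rewrite stable_mellin_ratio//; move: ta; lra.
Qed.

Lemma stable_mellin_shift_gt0 (s : R) (n : nat) : 0 <= s -> 0 < m s n.
Proof.
move=> s0; apply: stable_mellin_gt0 => //.
have : 0 <= n%:R * alpha by rewrite mulr_ge0// ltW.
move: ta; lra.
Qed.

(** The factors with index below [k] are replaced by 1, and the moments of the
    others telescope. *)
Lemma renewal_moment (s : R) (k n : nat) : 0 <= s -> (k <= n)%N ->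
  (\int[P]_w (expR (- (s * (renewal_epoch V n w - renewal_epoch V k w))))%:E =
   ((m s k / m s n) * (m 0 n / m 0 k))%:E)%E.
Proof.
move=> s0 kn.
pose h (i : nat) (x : R) : R := if (k <= i)%N then expR (s * ln (1 - x)) else 1.
have mh i : measurable_fun setT (h i).
  rewrite /h; case: (k <= i)%N => //.
  apply: measurableT_comp => //; apply: measurable_funM => //.
  by apply: measurableT_comp => //; exact: measurable_funB.
have h0 i x : 0 <= h i x by rewrite /h; case: ifP => // _; exact: expR_ge0.
have hE i : (\int[P]_w (h i (V i w))%:E = (if (k <= i)%N then
    ((m s i / m s i.+1) * (m 0 i.+1 / m 0 i)) else 1)%:E)%E.
  rewrite /h; case: (k <= i)%N; first exact: factor_moment.
  rewrite (integral_cst P measurableT 1%E) mul1e; exact: probability_setT.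
transitivity (\int[P]_w (\prod_(i < n) h i (V i w))%:E)%E.
  apply: eq_integral => w _; congr _%:E.
  rewrite -(big_mkord xpredT (fun i => h i (V i w))) (big_cat_nat (leq0n k) kn)/=.
  rewrite big1_seq ?mul1r; last first.
    move=> i; rewrite mem_index_iota/= => ik; rewrite /h ifF//.
    by apply/negbTE; rewrite -ltnNge.
  rewrite /renewal_epoch -!(big_mkord xpredT (fun i => - ln (1 - V i w))).
  rewrite (big_cat_nat (leq0n k) kn)/= addrAC subrr add0r.
  rewrite sumrN mulrN opprK mulr_sumr expR_sum.
  rewrite !big_seq; apply: eq_bigr => i; rewrite mem_index_iota => /andP[ki _].
  by rewrite /h ki.
rewrite expectation_prod//; last by move=> i; rewrite hE.
under eq_bigr do rewrite hE.
rewrite -(big_mkord xpredT (fun i => (if (k <= i)%N then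
    ((m s i / m s i.+1) * (m 0 i.+1 / m 0 i)) else 1)%:E)).
rewrite (big_cat_nat (leq0n k) kn)/= big1_seq ?mul1e; last first.
  move=> i; rewrite mem_index_iota/= => ik; rewrite ifF//.
  by apply/negbTE; rewrite -ltnNge.
have ps i : 0 < m s i by exact: stable_mellin_shift_gt0.
have p0 i : 0 < m 0 i by exact: stable_mellin_shift_gt0.
move: (m s) (m 0) ps p0 => f g f0 g0 {h mh h0 hE}.
elim: n kn => [|n IH].
  by rewrite leqn0 => /eqP ->; rewrite big_geq// !mulfV ?mulr1// gt_eqF.
rewrite leq_eqVlt => /predU1P[->|]; last first.
  rewrite ltnS => kn; rewrite big_nat_recr//= IH// kn -EFinM; congr _%:E.
  by field; rewrite !gt_eqF.
by rewrite big_geq// !mulfV ?mulr1// gt_eqF.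
Qed.

End renewal_moment.

(** * Exponential moments of the centred epochs *)

Section near_one.
Variable R : realType.
Implicit Types u v : nat -> R.

(** u n = 1 + O(1/n).  The rate, and not only the limit 1, is what makes the
    squared increments summable along a sparse grid. *)
Definition near1 u := exists C, 0 <= C /\ exists N : nat, (0 < N)%N /\
  forall n, (N <= n)%N -> `|u n - 1| <= C / n%:R.

Lemma near1M u v : near1 u -> near1 v -> near1 (fun n => u n * v n).
Proof.
move=> [C [C0 [N [N0 HC]]]] [D [D0 [M [M0 HD]]]].
exists (C * (1 + D) + D); split; first by rewrite addr_ge0 ?mulr_ge0 ?addr_ge0.
exists (maxn N M); split; first by rewrite leq_max N0.
move=> n; rewrite geq_max => /andP[Nn Mn].
have n0 : 0 < n%:R :> R by rewrite ltr0n (leq_trans N0).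
have n1 : n%:R^-1 <= 1 :> R by rewrite invf_le1// ler1n (leq_trans N0).
have -> : u n * v n - 1 = (u n - 1) * v n + (v n - 1) by ring.
apply: (le_trans (ler_normD _ _)); rewrite [leRHS]mulrDl lerD ?HD// normrM mulrAC.
apply: ler_pM; rewrite ?HC//.
have -> : v n = 1 + (v n - 1) by ring.
apply: (le_trans (ler_normD _ _)); rewrite normr1 lerD2l.
by apply: (le_trans (HD _ Mn)); rewrite ler_piMr.
Qed.

Lemma near1_ge_half u : near1 u ->
  exists N : nat, forall n, (N <= n)%N -> 2^-1 <= u n.
Proof.
move=> [C [C0 [N [N0 HC]]]].
exists (maxn N (Num.bound (2 * C))) => n; rewrite geq_max => /andP[Nn Cn].
have n0 : 0 < n%:R :> R by rewrite ltr0n (leq_trans N0).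
have := HC _ Nn; rewrite ler_norml => /andP[+ _].
have : C / n%:R <= 2^-1.
  rewrite ler_pdivrMr// -ler_pdivrMl ?invr_gt0// invrK.
  apply: le_trans (ltW (archi_boundP _)) _; first by rewrite mulr_ge0.
  by rewrite ler_nat.
move: (C / _) => e; lra.
Qed.

Lemma near1V u : near1 u -> near1 (fun n => (u n)^-1).
Proof.
move=> u1; have [M HM] := near1_ge_half u1.
have [C [C0 [N [N0 HC]]]] := u1.
exists (C * 2); split; first by rewrite mulr_ge0.
exists (maxn N M); split; first by rewrite leq_max N0.
move=> n; rewrite geq_max => /andP[Nn Mn].
have un := HM _ Mn; have un0 : 0 < u n by lra.
have -> : (u n)^-1 - 1 = - ((u n - 1) * (u n)^-1) by field; rewrite gt_eqF.
rewrite normrN normrM mulrAC ler_pM ?HC// ger0_norm ?invr_ge0 ?(ltW un0)//.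
by rewrite -[leRHS]invrK lef_pV2 ?posrE.
Qed.

Lemma near1_Gamma_quot (c q : R) : 0 < c -> 0 <= q ->
  near1 (fun n => Gamma_quot (c * n%:R) q).
Proof.
move=> c0 q0; have [C C0 HC] := Gamma_quot_near1 q0 c0.
exists (C / c); split; first by rewrite divr_ge0// ltW.
exists 1%N; split => // n n1.
have n0 : 0 < n%:R :> R by rewrite ltr0n.
have cn : c <= c * n%:R by rewrite ler_peMr ?(ltW c0)// ler1n.
by apply: (le_trans (HC _ cn)); rewrite invfM mulrA.
Qed.

Lemma near1_cvg u : near1 u -> u n @[n --> \oo] --> (1 : R).
Proof.
move=> [C [C0 [N [N0 HC]]]]; apply/cvgrPdist_le => /= e e0.
exists (maxn N (Num.bound (C / e))) => // n /=; rewrite geq_max => /andP[Nn Cn].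
have n0 : 0 < n%:R :> R by rewrite ltr0n (leq_trans N0).
rewrite distrC; apply: (le_trans (HC _ Nn)).
rewrite ler_pdivrMr// mulrC -ler_pdivrMr//.
apply: le_trans (ltW (archi_boundP _)) _; first by rewrite divr_ge0// ltW.
by rewrite ler_nat.
Qed.

(** The bound is uniform in [n]: it lets [k] alone control an increment from
    [k] to [n]. *)
Lemma near1_ratio u : near1 u -> exists C, 0 <= C /\ exists N : nat, (0 < N)%N /\
  forall k n, (N <= k)%N -> (k <= n)%N -> `|u n / u k - 1| <= C / k%:R.
Proof.
move=> u1; have [M HM] := near1_ge_half u1.
have [C [C0 [N [N0 HC]]]] := u1.
exists (C * 2 * 2); split; first by rewrite !mulr_ge0.
exists (maxn N M); split; first by rewrite leq_max N0.
move=> k n; rewrite geq_max => /andP[Nk Mk] kn.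
have k0 : 0 < k%:R :> R by rewrite ltr0n (leq_trans N0).
have uk := HM _ Mk; have uk0 : 0 < u k by lra.
have -> : u n / u k - 1 = ((u n - 1) - (u k - 1)) * (u k)^-1 by field; rewrite gt_eqF.
rewrite normrM mulrAC ler_pM//; last first.
  rewrite ger0_norm ?invr_ge0 ?(ltW uk0)//.
  by rewrite -[leRHS]invrK lef_pV2 ?posrE.
apply: (le_trans (ler_normB _ _)); rewrite mulrAC mulr_natr mulr2n lerD ?HC//.
apply: (le_trans (HC _ (leq_trans Nk kn))); rewrite ler_wpM2l// lef_pV2 ?posrE ?ler_nat//.
by rewrite ltr0n (leq_trans N0)// (leq_trans Nk).
Qed.

End near_one.

Section normalisation.
Variables (R : realType) (alpha theta : R).
Hypotheses (a0 : 0 < alpha) (a1 : alpha < 1) (ta : - alpha < theta).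

(** The deterministic centring of T_n; the constant - log alpha is produced by
    the quotient of powers of alpha n in [near1_moment_ratio]. *)
Definition log_scale (n : nat) : R := (alpha^-1 - 1) * ln n%:R - ln alpha.

(** The part of E e^(s X_n) that depends on n. *)
Definition moment_ratio (s : R) (n : nat) : R :=
  expR (s * log_scale n) *
  (stable_mellin alpha (theta + n%:R * alpha + 0) /
   stable_mellin alpha (theta + n%:R * alpha + s)).

(** Each of the four Gamma functions is compared with Gamma n or with
    Gamma (alpha n).  These two cancel, and the remaining powers of n and of
    alpha n are exactly the inverse of the normalising factor. *)
Lemma near1_moment_ratio (s : R) : 0 <= s -> near1 (moment_ratio s).
Proof.
move=> s0.
have t1 : 0 <= theta + 1 by move: ta a1; lra.
have q0 : 0 <= theta / alpha + 1 by apply/ltW/stable_arg_gt0.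
have sa : 0 <= s / alpha by rewrite divr_ge0// ltW.
pose u n := (Gamma_quot (alpha * n%:R) (theta + 1 + s) *
     (Gamma_quot (alpha * n%:R) (theta + 1))^-1) *
  (Gamma_quot (1 * n%:R) (theta / alpha + 1) *
     (Gamma_quot (1 * n%:R) (theta / alpha + 1 + s / alpha))^-1).
have nu : near1 u.
  apply: near1M; apply: near1M.
  - by apply: near1_Gamma_quot => //; rewrite addr_ge0.
  - by apply: near1V; apply: near1_Gamma_quot.
  - exact: near1_Gamma_quot.
  - by apply: near1V; apply: near1_Gamma_quot => //; rewrite addr_ge0.
have uE n : (0 < n)%N -> u n = moment_ratio s n.
  move=> n0; have np : 0 < n%:R :> R by rewrite ltr0n.
  have anp : 0 < alpha * n%:R by rewrite mulr_gt0.
  rewrite /u mul1r /moment_ratio /stable_mellin /Gamma_quot.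
  have -> : (theta + n%:R * alpha + 0) / alpha + 1 = n%:R + (theta / alpha + 1).
    by field; rewrite gt_eqF.
  have -> : (theta + n%:R * alpha + s) / alpha + 1 =
      n%:R + (theta / alpha + 1 + s / alpha) by field; rewrite gt_eqF.
  have -> : theta + n%:R * alpha + 0 + 1 = alpha * n%:R + (theta + 1) by ring.
  have -> : theta + n%:R * alpha + s + 1 = alpha * n%:R + (theta + 1 + s) by ring.
  have A1 : 0 < n%:R + (theta / alpha + 1) by lra.
  have A2 : 0 < n%:R + (theta / alpha + 1 + s / alpha) by lra.
  have A3 : 0 < alpha * n%:R + (theta + 1) by lra.
  have A4 : 0 < alpha * n%:R + (theta + 1 + s) by lra.
  have := (Gamma_gt0 A1, Gamma_gt0 A2, Gamma_gt0 A3, Gamma_gt0 A4).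
  move=> [[[G1 G2] G3] G4].
  have G5 := Gamma_gt0 np.
  have G6 := Gamma_gt0 anp.
  have pE : expR (s * log_scale n) =
    (alpha * n%:R) `^ (theta + 1) * n%:R `^ (theta / alpha + 1 + s / alpha) /
    ((alpha * n%:R) `^ (theta + 1 + s) * n%:R `^ (theta / alpha + 1)).
    rewrite !powR_expR// lnM ?posrE// -!expRD -expRN -expRD; congr expR.
    rewrite /log_scale; field; by rewrite gt_eqF.
  rewrite pE.
  have p1 := powR_gt0 (theta + 1) anp.
  have p2 := powR_gt0 (theta + 1 + s) anp.
  have p3 := powR_gt0 (theta / alpha + 1) np.
  have p4 := powR_gt0 (theta / alpha + 1 + s / alpha) np.
  move: (Gamma (n%:R + (theta / alpha + 1)))
    (Gamma (n%:R + (theta / alpha + 1 + s / alpha)))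
    (Gamma (alpha * n%:R + (theta + 1))) (Gamma (alpha * n%:R + (theta + 1 + s)))
    (Gamma n%:R) (Gamma (alpha * n%:R))
    ((alpha * n%:R) `^ (theta + 1)) ((alpha * n%:R) `^ (theta + 1 + s))
    (n%:R `^ (theta / alpha + 1)) (n%:R `^ (theta / alpha + 1 + s / alpha))
    G1 G2 G3 G4 G5 G6 p1 p2 p3 p4.
  by move=> *; field; rewrite !gt_eqF.
have [C [C0 [N [N0 HC]]]] := nu.
exists C; split=> //; exists N; split => // n Nn.
by rewrite -uE ?HC// (leq_trans N0).
Qed.

End normalisation.

Section increments.
Context d (Omega : measurableType d) (R : realType) (P : probability Omega R).
Variables (alpha theta : R) (V : nat -> {RV P >-> R}).
Hypotheses (a0 : 0 < alpha) (a1 : alpha < 1) (ta : - alpha < theta).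
Hypothesis indepV : independent_RVs V.
Hypothesis betaV : forall j : nat,
  is_beta (1 - alpha) (theta + j.+1%:R * alpha) (V j).

(** The epoch comes with a minus sign because e^(- s T_n) is almost surely
    bounded, hence integrable, for every s >= 0. *)
Definition centred_epoch (n : nat) (w : Omega) : R :=
  log_scale alpha n - renewal_epoch V n w.

Lemma measurable_renewal_epoch n : measurable_fun setT (renewal_epoch V n).
Proof.
apply: measurable_sum => i; apply: measurableT_comp => //.
apply: measurableT_comp; first exact: measurable_ln.
exact: measurable_funB.
Qed.

Lemma measurable_centred_epoch n : measurable_fun setT (centred_epoch n).
Proof. by apply: measurable_funB => //; exact: measurable_renewal_epoch. Qed.

Lemma centred_increment_moment (s : R) (k n : nat) : 0 <= s -> (k <= n)%N ->
  (\int[P]_w (expR (s * (centred_epoch n w - centred_epoch k w)))%:E =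
   (moment_ratio alpha theta s n / moment_ratio alpha theta s k)%:E)%E.
Proof.
move=> s0 kn.
transitivity ((expR (s * (log_scale alpha n - log_scale alpha k)))%:E *
  \int[P]_w (expR (- (s * (renewal_epoch V n w - renewal_epoch V k w))))%:E)%E.
  rewrite -ge0_integralZl//; last first.
    apply/measurable_EFinP; apply: measurableT_comp => //.
    apply: measurableT_comp => //; apply: measurable_funM => //.
    by apply: measurable_funB; exact: measurable_renewal_epoch.
  apply: eq_integral => w _; rewrite -EFinM -expRD; congr (expR _)%:E.
  by rewrite /centred_epoch; ring.
rewrite (renewal_moment a0 a1 ta indepV betaV)// -EFinM; congr _%:E.
rewrite /moment_ratio mulrBr expRB.
have h i t : 0 <= t -> 0 < stable_mellin alpha (theta + i%:R * alpha + t).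
  by move=> t0; apply: stable_mellin_shift_gt0.
have := (h n 0 (lexx _), h k 0 (lexx _), h n s s0, h k s s0).
have := (expR_gt0 (s * log_scale alpha n), expR_gt0 (s * log_scale alpha k)).
move: (expR _) (expR _) (stable_mellin alpha _) (stable_mellin alpha _)
  (stable_mellin alpha _) (stable_mellin alpha _).
by move=> e1 e2 m1 m2 m3 m4 [? ?] [[[? ?] ?] ?]; field; rewrite !gt_eqF.
Qed.

(** [centred_increment_moment] from index 0, where the epoch is 0 and where the
    value of [log_scale] cancels whatever it is. *)
Lemma centred_epoch_moment (s : R) (n : nat) : 0 <= s ->
  (\int[P]_w (expR (s * centred_epoch n w))%:E =
   (stable_mellin alpha (theta + s) / stable_mellin alpha theta *
     moment_ratio alpha theta s n)%:E)%E.
Proof.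
move=> s0.
transitivity ((expR (s * log_scale alpha 0))%:E *
  \int[P]_w (expR (s * (centred_epoch n w - centred_epoch 0 w)))%:E)%E.
  rewrite -ge0_integralZl//; last first.
    apply/measurable_EFinP; apply: measurableT_comp => //.
    apply: measurable_funM => //.
    by apply: measurable_funB; exact: measurable_centred_epoch.
  apply: eq_integral => w _; rewrite -EFinM -expRD; congr (expR _)%:E.
  by rewrite /centred_epoch /renewal_epoch big_ord0; ring.
rewrite centred_increment_moment// -EFinM; congr _%:E.
rewrite [moment_ratio _ _ _ 0]/moment_ratio mul0r !addr0.
have h t : 0 <= t -> 0 < stable_mellin alpha (theta + t).
  by move=> t0; apply: stable_mellin_gt0 => //; move: ta; lra.
have := (h _ s0, h _ (lexx 0)); rewrite addr0.
have := expR_gt0 (s * log_scale alpha 0).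
move: (expR _) (stable_mellin alpha _) (stable_mellin alpha _) (moment_ratio _ _ _ _).
by move=> e1 m1 m2 mr ? [? ?]; field; rewrite !gt_eqF.
Qed.

(** Expanding the square leaves r2 - 2 r1 + 1, where the moments r1 and r2 of
    orders 1 and 2 are both 1 + O(1/k). *)
Lemma centred_increment_sq : exists C, 0 <= C /\ exists N : nat, (0 < N)%N /\
  forall k n, (N <= k)%N -> (k <= n)%N ->
  (\int[P]_w ((expR (centred_epoch n w - centred_epoch k w) - 1) ^+ 2)%:E
    <= (C / k%:R)%:E)%E.
Proof.
have [C1 [C10 [N1 [N10 H1]]]] := near1_ratio (near1_moment_ratio a0 a1 ta ler01).
have [C2 [C20 [N2 [N20 H2]]]] := near1_ratio (near1_moment_ratio a0 a1 ta (ler0n R 2)).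
exists (C2 + 2 * C1); split; first by rewrite addr_ge0 ?mulr_ge0.
exists (maxn N1 N2); split; first by rewrite leq_max N10.
move=> k n; rewrite geq_max => /andP[N1k N2k] kn.
pose D w := expR (centred_epoch n w - centred_epoch k w).
have mD : measurable_fun setT D.
  apply: measurableT_comp => //.
  by apply: measurable_funB; exact: measurable_centred_epoch.
have [r1 [D1 h1]] : exists r, (\int[P]_w (D w)%:E = r%:E)%E /\ `|r - 1| <= C1 / k%:R.
  exists (moment_ratio alpha theta 1 n / moment_ratio alpha theta 1 k).
  split; last exact: H1.
  rewrite -(centred_increment_moment ler01 kn).
  by apply: eq_integral => w _; rewrite mul1r.
have [r2 [D2 h2]] : exists r, (\int[P]_w (D w ^+ 2)%:E = r%:E)%E /\ `|r - 1| <= C2 / k%:R.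
  exists (moment_ratio alpha theta 2 n / moment_ratio alpha theta 2 k).
  split; last exact: H2.
  rewrite -(centred_increment_moment (ler0n R 2) kn).
  by apply: eq_integral => w _; rewrite expRM_natl.
have D0 w : 0 <= D w by exact: expR_ge0.
have mDsq : measurable_fun setT (fun w => (D w - 1) ^+ 2).
  by apply: measurable_funX; exact: measurable_funB.
have sum : (\int[P]_w ((D w - 1) ^+ 2)%:E + 2%:E * \int[P]_w (D w)%:E =
    \int[P]_w (D w ^+ 2)%:E + 1)%E.
  have mD' : measurable_fun setT (EFin \o D) by exact/measurable_EFinP.
  have D'0 w : setT w -> (0 <= (EFin \o D) w)%E by rewrite lee_fin.
  rewrite -(@ge0_integralZl _ _ _ P setT measurableT (EFin \o D) mD' 2%:E D'0)//.
  rewrite -ge0_integralD//; last 4 first.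
  - by move=> w _; rewrite lee_fin sqr_ge0.
  - exact/measurable_EFinP.
  - by move=> w _; rewrite -EFinM lee_fin mulr_ge0.
  - exact: measurable_funeM.
  transitivity (\int[P]_w ((D w ^+ 2)%:E + (cst 1%E) w))%E.
    apply: eq_integral => w _; rewrite -EFinM -!EFinD; congr _%:E; ring.
  rewrite ge0_integralD//.
  - rewrite (integral_cst P measurableT 1%E) mul1e; congr (_ + _)%E.
    exact: probability_setT.
  - by move=> w _; rewrite lee_fin exprn_ge0.
  - by apply/measurable_EFinP; exact: measurable_funX.
move: sum; rewrite D1 D2; set I := (\int[P]_w _)%E.
move: h1 h2; rewrite !ler_norml => /andP[h1 _] /andP[_ h2].
case: I => [r||]//; rewrite -!EFinM -!EFinD => -[E]; rewrite lee_fin.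
have -> : (C2 + 2 * C1) / k%:R = C2 / k%:R + 2 * (C1 / k%:R) by ring.
lra.
Qed.

End increments.

(** * Almost sure convergence of the centred epochs *)

Section real_sequences.
Variable R : realType.
Implicit Types (x y T : nat -> R) (K : nat).

Lemma sum_inv_sq_le1 K m :
  \sum_(0 <= k < m) ((k + K.+2)%:R ^+ 2)^-1 <= 1 :> R.
Proof.
suff : \sum_(0 <= k < m) ((k + K.+2)%:R ^+ 2)^-1 <= 1 - (m + K.+1)%:R^-1 :> R.
  by move=> /le_trans; apply; rewrite gerBl invr_ge0.
elim: m => [|m IH]; first by rewrite big_nil subr_ge0 invf_le1 ?ler1n ?ltr0n.
rewrite big_nat_recr//=; apply: le_trans (lerD IH (lexx _)) _.
have -> : (m + K.+2)%:R = (m + K.+1)%:R + 1 :> R by rewrite natr1 addnS.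
have -> : (m.+1 + K.+1)%:R = (m + K.+1)%:R + 1 :> R by rewrite natr1 addSn.
have : 0 < (m + K.+1)%:R :> R by rewrite ltr0n addnS.
move: (_%:R) => z z0; have z1 : 0 < z + 1 by lra.
have E : z^-1 - (z + 1)^-1 = (z * (z + 1))^-1 by field; rewrite !gt_eqF.
have : ((z + 1) ^+ 2)^-1 <= (z * (z + 1))^-1.
  by rewrite lef_pV2 ?posrE ?mulr_gt0 ?exprn_gt0// expr2 ler_pM2r//; lra.
move: E; move: (z^-1) ((z + 1)^-1) (_ ^-1) ((_ ^+ 2)^-1) => *; lra.
Qed.

Lemma norm_le_expR_sub1 (z : R) : `|expR z - 1| <= 2^-1 ->
  `|z| <= 2 * `|expR z - 1|.
Proof.
move=> h; have h1 := expR_ge1Dx z; have h2 := expR_ge1Dx (- z).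
have ez := expR_gt0 z; rewrite expRN in h2.
have h3 : 1 - expR z = (expR z)^-1 * expR z - expR z by rewrite mulVf ?gt_eqF.
move: (expR z) (expR z)^-1 h h1 h2 ez h3 => e e' h h1 h2 ez h3.
move: h; rewrite ler_norml => /andP[e1 e2].
have [ep|en] := leP 0 (e - 1).
  rewrite (ger0_norm ep) ler_norml; apply/andP; split; nra.
rewrite (ltr0_norm en) ler_norml; apply/andP; split; nra.
Qed.

(** With D = |e^(y_(k+1) - y_k) - 1| and any weight c > 0 one has
    D <= 1/c + c D^2.  For the weights c = (k + K + 2)^2 the first terms are
    summable, so the D are, and then so are the increments of y, since
    |z| <= 2 |e^z - 1| for small z. *)
Lemma log_ratio_cvg (y : nat -> R) K (M : R) :
  (forall m, \sum_(0 <= k < m)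
     (k + K.+2)%:R ^+ 2 * (expR (y k.+1 - y k) - 1) ^+ 2 <= M) ->
  cvgn y.
Proof.
move=> HM; pose D k := `|expR (y k.+1 - y k) - 1|.
have D0 k : 0 <= D k by exact: normr_ge0.
have Dle k : D k <= ((k + K.+2)%:R ^+ 2)^-1 +
    (k + K.+2)%:R ^+ 2 * (expR (y k.+1 - y k) - 1) ^+ 2.
  rewrite -[X in _ * X]real_normK ?num_real// -/(D k).
  have : 0 < (k + K.+2)%:R ^+ 2 :> R by rewrite exprn_gt0// ltr0n addnS.
  have : 0 <= D k by exact: normr_ge0.
  move: (_ ^+ 2) (D k) => c e e0 c0.
  have E : c^-1 * (c * e - 1) ^+ 2 = c * e ^+ 2 - 2 * e + c^-1 by field; rewrite gt_eqF.
  have : 0 <= c^-1 * (c * e - 1) ^+ 2 by rewrite mulr_ge0 ?sqr_ge0// invr_ge0 ltW.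
  by rewrite E; lra.
have cD : cvgn (series D).
  apply: nondecreasing_is_cvgn.
    by apply/nondecreasing_seqP => n; rewrite /series/= big_nat_recr//= lerDl D0.
  exists (1 + M) => _ [m _ <-]; rewrite /series/=.
  apply: (@le_trans _ _ (\sum_(0 <= k < m) (((k + K.+2)%:R ^+ 2)^-1 +
    (k + K.+2)%:R ^+ 2 * (expR (y k.+1 - y k) - 1) ^+ 2))).
    exact: ler_sum.
  by rewrite big_split/= lerD// sum_inv_sq_le1.
have := cvg_series_cvg_0 cD => /cvgrPdist_le/(_ 2^-1 ltac:(by rewrite invr_gt0)).
move=> [N _ HN].
have Dhalf k : D (k + N)%N <= 2^-1.
  by have := HN (k + N)%N (leq_addl _ _); rewrite sub0r normrN /D normr_id.
pose z k := y (k + N).+1 - y (k + N)%N.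
have cz : cvgn (series z).
  apply: normed_cvg; apply: (@series_le_cvg _ _ (fun k => 2 * D (k + N)%N)) => //.
  - by move=> k; exact: normr_ge0.
  - by move=> k; rewrite mulr_ge0 ?D0.
  - by move=> k; apply: norm_le_expR_sub1; exact: Dhalf.
  - rewrite (_ : (fun k => _) = 2 *: (fun k => D (k + N)%N)); last first.
      by apply/funext => k.
    apply: is_cvg_seriesZ.
    apply: nondecreasing_is_cvgn.
      by apply/nondecreasing_seqP => n; rewrite /series/= big_nat_recr//= lerDl D0.
    exists (limn (series D)) => _ [m _ <-]; rewrite /series/=.
    apply: (@le_trans _ _ (series D (m + N)%N)); last first.
      apply: nondecreasing_cvgn_le => //.
      by apply/nondecreasing_seqP => n; rewrite /series/= big_nat_recr//= lerDl D0.
    rewrite /series/= -{1}(addnK N m) -(big_addn 0 (m + N) N xpredT D) add0n.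
    rewrite [leRHS](big_cat_nat (leq0n N) (leq_addl m N))/= lerDr.
    by apply: sumr_ge0 => k _; exact: D0.
have zE m : series z m = y (m + N)%N - y N.
  by rewrite /series/= (@telescope_sumr_eq _ 0%N m (fun k => y (k + N)%N)).
suff : cvgn (fun n => y (n + N)%N).
  by move=> /cvg_ex[l]; rewrite cvg_shiftn => ?; apply/cvg_ex; exists l.
rewrite (_ : (fun n => _) = (fun n => series z n + y N)).
  by apply: is_cvgD => //; exact: is_cvg_cst.
by apply/funext => n; rewrite zE subrK.
Qed.

End real_sequences.

Section interpolation.
Variable R : realType.

Lemma ln_succ_sub (n : nat) : (0 < n)%N -> ln n.+1%:R - ln n%:R <= n%:R^-1 :> R.
Proof.
move=> n0; have np : 0 < n%:R :> R by rewrite ltr0n.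
rewrite -ln_div ?posrE ?ltr0n// -natr1 mulrDl mulfV ?gt_eqF// mul1r.
by apply: le_ln1Dx; apply: lt_trans (_ : 0 < _); rewrite ?oppr_lt0 ?invr_gt0.
Qed.

(** The exponent 4 balances two needs: the bound O(1/q^4) for the squared
    increment from q^4 must remain summable after multiplication by q^2, and
    log (q+1)^4 - log q^4 must tend to 0.  The shift starts the grid beyond the
    index [K] from which the moment bounds hold. *)
Definition quartic_grid (K k : nat) : nat := ((k + K.+2) ^ 4)%N.

Lemma quartic_grid_bracket K k1 n : (quartic_grid K k1 <= n)%N ->
  exists k, (k1 <= k)%N /\ (quartic_grid K k <= n < quartic_grid K k.+1)%N.
Proof.
move=> k1n; have ex : exists k, (quartic_grid K k <= n)%N by exists k1.
have ub k : (quartic_grid K k <= n)%N -> (k <= n)%N.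
  apply: leq_trans; rewrite /quartic_grid; apply: (@leq_trans (k + K.+2)%N).
    exact: leq_addr.
  by rewrite -{1}(expn1 (k + K.+2)%N) leq_exp2l// addnS ltnS addnS.
case: (ex_maxnP ex ub) => k kn kmax; exists k; split; first exact: kmax.
by rewrite kn ltnNge; apply/negP => /kmax; rewrite ltnn.
Qed.

(** Between two grid points both [T] and the logarithm lie between their
    values at these points, and the logarithm varies by at most 4/q. *)
Lemma cvg_of_quartic_grid (T : nat -> R) (c b l : R) (K : nat) : 0 <= c ->
  nondecreasing_seq T ->
  c * ln (quartic_grid K k)%:R + b - T (quartic_grid K k) @[k --> \oo] --> l ->
  c * ln n%:R + b - T n @[n --> \oo] --> l.
Proof.
move=> c0 nT cl; apply/cvgrPdist_le => /= e e0.
have e20 : 0 < e / 2 by lra.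
move/cvgrPdist_le : cl => /(_ _ e20)[k1 _ Hk1].
pose k2 := maxn k1 (Num.bound (4 * c / (e / 2))).
exists (quartic_grid K k2) => // n /= k2n.
have [k [k2k /andP[g1 g2]]] := quartic_grid_bracket k2n.
have k1k : (k1 <= k)%N by apply: leq_trans k2k; exact: leq_maxl.
have n0 : (0 < n)%N by apply: leq_trans g1; rewrite expn_gt0 addnS.
have step : c * ln (quartic_grid K k.+1)%:R - c * ln (quartic_grid K k)%:R <= e / 2.
  have qR0 j : 0 < (j + K.+2)%:R :> R by rewrite ltr0n addnS.
  rewrite /quartic_grid !natrX !lnXn ?qR0// -mulrBr -mulrnBl.
  have q0 : (0 < k + K.+2)%N by rewrite addnS.
  have qR : 0 < (k + K.+2)%:R :> R by rewrite ltr0n.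
  have H : ln (k.+1 + K.+2)%:R - ln (k + K.+2)%:R <= (k + K.+2)%:R^-1 :> R.
    by rewrite addSn; exact: ln_succ_sub.
  apply: (@le_trans _ _ (c * ((k + K.+2)%:R^-1 *+ 4))).
    by rewrite ler_wpM2l// lerMn2r H orbT.
  have -> : c * ((k + K.+2)%:R^-1 *+ 4) = (4 * c) / (k + K.+2)%:R by ring.
  rewrite ler_pdivrMr// [leRHS]mulrC -ler_pdivrMr//.
  have bnd : 0 <= 4 * c / (e / 2) by rewrite divr_ge0 ?mulr_ge0// ltW.
  apply: le_trans (ltW (archi_boundP bnd)) _; rewrite ler_nat.
  by apply: leq_trans (leq_addr _ _); apply: leq_trans k2k; exact: leq_maxr.
have lnn (i j : nat) : (0 < i)%N -> (i <= j)%N -> c * ln i%:R <= c * ln j%:R.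
  move=> i0 ij; rewrite ler_wpM2l// ler_ln ?posrE ?ltr0n ?ler_nat//.
  exact: leq_trans ij.
have gk0 i : (0 < quartic_grid K i)%N by rewrite expn_gt0 addnS.
have := (lnn _ _ (gk0 k) g1, lnn _ _ n0 (ltnW g2), nT _ _ g1, nT _ _ (ltnW g2)).
move=> [[[h1 h2] h3] h4].
have := Hk1 k k1k; have := Hk1 k.+1 (leq_trans k1k (leqnSn _)).
rewrite /= !ler_norml => /andP[h5 h6] /andP[h7 h8].
apply/andP; split; lra.
Qed.

End interpolation.

Section almost_sure.
Context d (Omega : measurableType d) (R : realType) (P : probability Omega R).
Variables (alpha theta : R) (V : nat -> {RV P >-> R}).
Hypotheses (a0 : 0 < alpha) (a1 : alpha < 1) (ta : - alpha < theta).
Hypothesis indepV : independent_RVs V.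
Hypothesis betaV : forall j : nat,
  is_beta (1 - alpha) (theta + j.+1%:R * alpha) (V j).

Lemma beta_range_ae : {ae P, forall w, forall j, 0 < V j w < 1}.
Proof.
apply: ae_foralln => j; have [_ _ VE] := betaV j.
exists (V j @^-1` ~` `]0%R, 1%R[%classic); split.
- rewrite -[X in measurable X]setTI; apply: measurable_funP => //.
  exact: measurableC.
- have := VE (~` `]0%R, 1%R[%classic) (measurableC (measurable_itv _)).
  by rewrite setICl integral_set0.
- by move=> w /=; rewrite in_itv.
Qed.

Lemma renewal_epoch_nd w : (forall j, 0 < V j w < 1) ->
  nondecreasing_seq (fun n => renewal_epoch V n w).
Proof.
move=> V01; apply/nondecreasing_seqP => n; rewrite /renewal_epoch big_ord_recr/=.
by rewrite lerDl oppr_ge0 ln_le0// gerBl; case/andP: (V01 n) => /ltW.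
Qed.

(** The series of weighted squares has expectation at most C, so that it is
    almost surely finite. *)
Lemma centred_grid_sum_ae : exists K : nat, {ae P, forall w, exists M : R,
  forall m, \sum_(0 <= k < m) (k + K.+2)%:R ^+ 2 *
    (expR (centred_epoch alpha V (quartic_grid K k.+1) w -
       centred_epoch alpha V (quartic_grid K k) w) - 1) ^+ 2 <= M}.
Proof.
have [C [C0 [K [K0 HC]]]] := centred_increment_sq a0 a1 ta indepV betaV.
exists K.
pose G (k : nat) w : R := (k + K.+2)%:R ^+ 2 *
    (expR (centred_epoch alpha V (quartic_grid K k.+1) w -
       centred_epoch alpha V (quartic_grid K k) w) - 1) ^+ 2.
have G0 k w : 0 <= G k w by rewrite mulr_ge0 ?sqr_ge0.
have mG k : measurable_fun setT (G k).
  apply: measurable_funM => //; apply: measurable_funX.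
  apply: measurable_funB => //; apply: measurableT_comp => //.
  by apply: measurable_funB; exact: measurable_centred_epoch.
have mEG k : measurable_fun setT (EFin \o G k) by exact/measurable_EFinP.
have EG k : (\int[P]_w (G k w)%:E <= (C * ((k + K.+2)%:R ^+ 2)^-1)%:E)%E.
  have q1 : (1 < k + K.+2)%N by rewrite addnS ltnS addnS.
  have q0 : 0 < (k + K.+2)%:R :> R by rewrite ltr0n ltnW.
  have gK : (K <= quartic_grid K k)%N.
    rewrite /quartic_grid; apply: (@leq_trans (k + K.+2)%N).
      by rewrite -addSnnS -addSnnS leq_addl.
    by rewrite -{1}(expn1 (k + K.+2)%N) leq_exp2l.
  have gg : (quartic_grid K k <= quartic_grid K k.+1)%N.
    by rewrite leq_exp2r// leq_add2r.
  under eq_integral do rewrite EFinM.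
  rewrite ge0_integralZl//; last 2 first.
  - apply/measurable_EFinP; apply: measurable_funX.
    apply: measurable_funB => //; apply: measurableT_comp => //.
    by apply: measurable_funB; exact: measurable_centred_epoch.
  - by move=> w _; rewrite lee_fin sqr_ge0.
  apply: (@le_trans _ _ (((k + K.+2)%:R ^+ 2)%:E * (C / (quartic_grid K k)%:R)%:E)%E).
    by apply: lee_wpmul2l; [rewrite lee_fin sqr_ge0|exact: HC].
  rewrite -EFinM lee_fin /quartic_grid natrX.
  by rewrite le_eqVlt; apply/orP; left; apply/eqP; field; rewrite gt_eqF.
have intG : (\int[P]_w (\sum_(k <oo) (G k w)%:E) <= C%:E)%E.
  rewrite integral_nneseries//; last by move=> n w _; rewrite lee_fin.
  apply: lime_le.
    apply: is_cvg_nneseries => n _ _; apply: integral_ge0 => w _.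
    by rewrite lee_fin.
  apply: nearW => m.
  apply: (@le_trans _ _ (\sum_(0 <= k < m) (C * ((k + K.+2)%:R ^+ 2)^-1)%:E)%E).
    by apply: lee_sum => k _.
  rewrite sumEFin lee_fin -mulr_sumr ler_piMr// sum_inv_sq_le1//.
have sumG0 w : (0 <= \sum_(k <oo) (G k w)%:E)%E.
  by apply: nneseries_ge0 => n _ _; rewrite lee_fin.
have mS : measurable_fun setT (fun w => \sum_(k <oo) (G k w)%:E)%E.
  apply: (@ge0_emeasurable_sum _ _ _ setT (fun k w => (G k w)%:E) xpredT) => //.
    by move=> k w _ _; rewrite lee_fin.
  by move=> k _; exact: mEG.
have iS : P.-integrable setT (fun w => \sum_(k <oo) (G k w)%:E)%E.
  apply/integrableP; split; first exact: mS.
  apply: le_lt_trans (ltry C); apply: le_trans intG.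
  by rewrite le_eqVlt; apply/orP; left; apply/eqP; apply: eq_integral => w _; rewrite gee0_abs.
have := integrable_ae measurableT iS.
apply: filterS => w /(_ I) fin; exists (fine (\sum_(k <oo) (G k w)%:E)%E) => m.
rewrite -lee_fin fineK// -sumEFin.
apply: (@nneseries_lim_ge _ (fun k => (G k w)%:E) xpredT) => n _ _.
by rewrite lee_fin.
Qed.

Lemma centred_epoch_cvg_ae :
  {ae P, forall w, cvgn (fun n => centred_epoch alpha V n w)}.
Proof.
have [K HK] := centred_grid_sum_ae.
apply: filterS2 HK beta_range_ae => w [M HM] V01.
have /cvg_ex[l cl] := log_ratio_cvg HM.
apply/cvg_ex; exists l.
have c0 : 0 <= alpha^-1 - 1 by rewrite subr_ge0 invf_ge1// ltW.
exact: (@cvg_of_quartic_grid _ (fun n => renewal_epoch V n w) _ _ _ K c0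
  (renewal_epoch_nd V01) cl).
Qed.

End almost_sure.

(** * Laplace transforms approximated by moments *)

Section exp_taylor.
Variable R : realType.

Definition exp_alt_sum (K : nat) (x : R) : R :=
  \sum_(0 <= k < K) (- x) ^+ k / k`!%:R.

Lemma is_derive_exp_alt_sum K (x : R) :
  is_derive x 1 (exp_alt_sum K.+1) (- exp_alt_sum K x).
Proof.
elim: K => [|K IH].
  rewrite (_ : exp_alt_sum 1 = cst 1); last first.
    by apply/funext => y; rewrite /exp_alt_sum big_nat1 expr0 fact0 divr1.
  by rewrite /exp_alt_sum big_nil oppr0; exact: is_derive_cst.
have H1 : is_derive x 1 (fun y : R => K.+1`!%:R^-1 * (- y) ^+ K.+1)
    (- ((- x) ^+ K / K`!%:R)).
  have H0 : is_derive x 1 (-%R : R -> R) (- 1) by exact: is_deriveNid.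
  have H2 := @is_deriveX _ _ (-%R : R -> R) K.+1 x 1 (- 1) H0.
  have H3 := @is_deriveZ _ _ _ _ (K.+1`!%:R^-1) x 1 _ H2.
  rewrite (_ : (fun y => _) = K.+1`!%:R^-1 \*: (-%R ^+ K.+1 : R -> R)); last first.
    by apply/funext => y; rewrite /= fctE.
  apply: is_derive_eq; rewrite /GRing.scale/= factS natrM invfM.
  have k0 : K.+1%:R != 0 :> R by rewrite pnatr_eq0.
  have f0 : K`!%:R != 0 :> R by rewrite pnatr_eq0 -lt0n fact_gt0.
  by field; rewrite f0 addrC natr1.
rewrite (_ : exp_alt_sum K.+2 =
    exp_alt_sum K.+1 + (fun y => K.+1`!%:R^-1 * (- y) ^+ K.+1)); last first.
  by apply/funext => y; rewrite /exp_alt_sum big_nat_recr//= fctE mulrC.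
have -> : - exp_alt_sum K.+1 x = - exp_alt_sum K x + - ((- x) ^+ K / K`!%:R).
  by rewrite /exp_alt_sum big_nat_recr//= opprD.
exact: is_deriveD.
Qed.

(** The partial sums are alternately below and above e^(-x): the derivative of
    the signed error of order K + 1 is the signed error of order K, and all
    errors of positive order vanish at 0. *)
Lemma exp_alt_sum_sign K (x : R) : 0 <= x ->
  0 <= (-1) ^+ K * (expR (- x) - exp_alt_sum K x).
Proof.
elim: K x => [|K IH] x x0.
  by rewrite expr0 mul1r /exp_alt_sum big_nil subr0 expR_ge0.
pose f y := (-1) ^+ K.+1 * (expR (- y) - exp_alt_sum K.+1 y).
have df (y : R) : is_derive y 1 f ((-1) ^+ K * (expR (- y) - exp_alt_sum K y)).
  have := @is_derive_exp_alt_sum K y => H.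
  apply: is_derive_eq; rewrite /GRing.scale/= exprS; ring.
have f0 : f 0 = 0.
  rewrite /f oppr0 expR0 /exp_alt_sum big_nat_recl//= expr0 fact0 divr1.
  rewrite big1_seq ?addr0 ?subrr ?mulr0// => k _.
  by rewrite oppr0 expr0n/= mul0r.
rewrite -/(f x) -f0.
apply: (@ger0_derive1_le_cc _ f 0 x) => //.
- move=> y; rewrite in_itv/= => /andP[y0 _]; rewrite derive1E.
  by case: (df y) => _ ->; apply: IH; exact: ltW.
- apply: continuous_subspaceT => y.
  by apply/differentiable_continuous/derivable1_diffP; case: (df y).
- by rewrite in_itv/= lexx.
- by rewrite in_itv/= lexx x0.
Qed.

(** Two consecutive partial sums enclose e^(-x). *)
Lemma exp_alt_sum_approx K (x : R) : 0 <= x ->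
  `|expR (- x) - exp_alt_sum K x| <= x ^+ K / K`!%:R.
Proof.
move=> x0; have h1 := exp_alt_sum_sign K x0; have h2 := exp_alt_sum_sign K.+1 x0.
have -> : `|expR (- x) - exp_alt_sum K x| = (-1) ^+ K * (expR (- x) - exp_alt_sum K x).
  by rewrite -[RHS]ger0_norm// normrM normrX normrN1 expr1n mul1r.
move: h2; rewrite exprS {1}/exp_alt_sum big_nat_recr//= -/(exp_alt_sum K x).
have : (-1) ^+ K * ((- x) ^+ K / K`!%:R) = x ^+ K / K`!%:R :> R.
  by rewrite mulrA -exprMn mulN1r opprK.
move: ((- x) ^+ K / _) => u; move: (x ^+ K / _) => v.
move: (expR _) (exp_alt_sum _ _) ((-1) ^+ K) h1 => e s c h1 h3 h2; nra.
Qed.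

End exp_taylor.

Section moments_laplace.
Context d (T : measurableType d) (R : realType) (P : probability T R).

(** The Taylor bound, integrated.  It holds for every [K] whether or not the
    series of the moments converges. *)
Lemma laplace_moment_approx (U : T -> R) (M : nat -> R) (K : nat) :
  measurable_fun setT U -> (forall w, 0 <= U w) ->
  (forall k, (\int[P]_w (U w ^+ k)%:E = (M k)%:E)%E) ->
  `|\int[P]_w expR (- U w) - \sum_(0 <= k < K) (-1) ^+ k / k`!%:R * M k|
    <= M K / K`!%:R.
Proof.
move=> mU U0 HM.
have iU k : P.-integrable setT (EFin \o (fun w => U w ^+ k)).
  apply/integrableP; split; first by apply/measurable_EFinP; exact: measurable_funX.
  rewrite (eq_integral (fun w => (U w ^+ k)%:E)) ?HM ?ltry// => w _ /=.
  by rewrite ger0_norm// exprn_ge0.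
have RU k : \int[P]_w (U w ^+ k) = M k by rewrite /Rintegral HM.
have iE : P.-integrable setT (EFin \o (fun w => expR (- U w))).
  apply: (@bounded_integrable _ _ _ _ _ _ 1) => //.
    by apply: measurableT_comp => //; exact: measurableT_comp.
  move=> w _; rewrite ger0_norm ?expR_ge0// -expR0 ler_expR oppr_le0//.
have [iD RD] : P.-integrable setT (EFin \o (fun w => expR (- U w) - exp_alt_sum K (U w)))
   /\ \int[P]_w (expR (- U w) - exp_alt_sum K (U w)) =
     \int[P]_w expR (- U w) - \sum_(0 <= k < K) (-1) ^+ k / k`!%:R * M k.
  elim: K => [|K [iK RK]].
    rewrite /exp_alt_sum; split.
      by under [X in _.-integrable _ X]eq_fun do rewrite /= big_nil subr0.
    by under eq_Rintegral do rewrite big_nil subr0; rewrite big_nil subr0.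
  have E w : expR (- U w) - exp_alt_sum K.+1 (U w) =
     (expR (- U w) - exp_alt_sum K (U w)) - (-1) ^+ K / K`!%:R * U w ^+ K.
    by rewrite /exp_alt_sum big_nat_recr//= (exprNn (U w) K); ring.
  have iZ : P.-integrable setT (EFin \o (fun w => (-1) ^+ K / K`!%:R * U w ^+ K)).
    exact: (integrableZl measurableT ((-1) ^+ K / K`!%:R) (iU K)).
  split.
    have := integrableB measurableT iK iZ; apply: eq_integrable => // w _ /=.
    by rewrite E.
  under eq_Rintegral do rewrite E.
  rewrite RintegralB// RK RintegralZl// RU big_nat_recr//=; ring.
rewrite -RD; apply: (le_trans (le_normr_Rintegral _ _)) => //.
have -> : M K / K`!%:R = \int[P]_w (K`!%:R^-1 * U w ^+ K).
  by rewrite RintegralZl// RU mulrC.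
apply: le_Rintegral => //.
- exact: (integrable_abse iD).
- exact: (integrableZl measurableT (K`!%:R^-1) (iU K)).
- by move=> w _; rewrite [leRHS]mulrC; exact: exp_alt_sum_approx.
Qed.

End moments_laplace.

(** * Uniqueness of the Laplace transform *)

Section bernoulli.
Variable R : realType.

Lemma bernoulli_lb (y : R) m : 0 <= y <= 1 -> 1 - m%:R * y <= (1 - y) ^+ m.
Proof.
move=> /andP[y0 y1]; elim: m => [|m IH]; first by rewrite expr0 mul0r subr0.
rewrite exprS -natr1 mulrDl mul1r.
have : 0 <= m%:R * y ^+ 2 by rewrite mulr_ge0// sqr_ge0.
have : (1 - y) * (1 - m%:R * y) <= (1 - y) * (1 - y) ^+ m.
  by rewrite ler_wpM2l// subr_ge0.
rewrite expr2; move: ((1 - y) ^+ m) (m%:R) => p q; nra.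
Qed.

Lemma bernoulli_ub (y : R) m : 0 <= y <= 1 ->
  (1 - y) ^+ m * (1 + m%:R * y) <= 1.
Proof.
move=> /andP[y0 y1]; elim: m => [|m IH].
  by rewrite expr0 mul0r addr0 mulr1.
apply: le_trans IH; rewrite exprSr -mulrA ler_wpM2l ?exprn_ge0 ?subr_ge0//.
rewrite -natr1; have : 0 <= m%:R * y * y by rewrite !mulr_ge0.
move: (m%:R) => q; nra.
Qed.

End bernoulli.

Section laplace_uniqueness.
Variable R : realType.
Local Notation D := (`]0%R, +oo[%classic : set R).

(** Expanding the power shows that this is a linear combination of values of
    the Laplace transform.  For b = n log 2 / c, a = 0 and m = 2^n the
    integrand is (1 - u^n)^(2^n) with u = e^(- x log 2 / c); it tends to 1 for
    u < 1/2, that is x > c, and to 0 for x < c.  So tails can be recovered from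
    the Laplace transform.  The parameter [a] serves the induction on [m]. *)
Definition laplace_poly (mu : {measure set R -> \bar R}) (b a : R) (m : nat) : R :=
  \int[mu]_(x in D) ((1 - expR (- (b * x))) ^+ m * expR (- (a * x))).

Lemma laplace_poly_bounds (b a x : R) m : 0 <= b -> 0 <= a -> 0 < x ->
  0 <= (1 - expR (- (b * x))) ^+ m * expR (- (a * x)) <= 1.
Proof.
move=> b0 a0 x0.
have h (c : R) : 0 <= c -> 0 <= expR (- (c * x)) <= 1.
  move=> c0; apply/andP; split; first exact: expR_ge0.
  by rewrite -expR0 ler_expR oppr_le0 mulr_ge0// ltW.
have /andP[hb0 hb1] := h b b0; have /andP[ha0 ha1] := h a a0.
rewrite mulr_ge0 ?exprn_ge0 ?subr_ge0//= mulr_ile1 ?exprn_ge0 ?subr_ge0//.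
by rewrite exprn_ile1 ?subr_ge0// gerBl.
Qed.

Lemma measurable_laplace_poly (b a : R) m (E : set R) :
  measurable_fun E (fun x : R => (1 - expR (- (b * x))) ^+ m * expR (- (a * x))).
Proof.
have mexp (c : R) : measurable_fun setT (fun x : R => expR (- (c * x))).
  by apply: continuous_measurable_fun => x; exact: continuous_expRN.
apply: measurable_funTS; apply: measurable_funM => //.
by apply: measurable_funX; exact: measurable_funB.
Qed.

Lemma laplace_poly_integrable (mu : probability R R) (b a : R) m :
  0 <= b -> 0 <= a -> mu.-integrable D
   (EFin \o (fun x : R => (1 - expR (- (b * x))) ^+ m * expR (- (a * x)))).
Proof.
move=> b0 a0; apply: (@bounded_integrable _ _ _ _ _ _ 1) => //.
  exact: measurable_laplace_poly.
move=> x; rewrite mem0y => x0.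
by have /andP[h0 h1] := laplace_poly_bounds m b0 a0 x0; rewrite ger0_norm.
Qed.

Variables mu nu : probability R R.
Hypothesis laplaceE : forall s : R, 0 <= s ->
  \int[mu]_(x in D) expR (- (s * x)) = \int[nu]_(x in D) expR (- (s * x)).

Lemma laplace_polyE (b a : R) m : 0 <= b -> 0 <= a ->
  laplace_poly mu b a m = laplace_poly nu b a m.
Proof.
move=> b0; elim: m a => [|m IH] a a0.
  rewrite /laplace_poly; under eq_Rintegral do rewrite expr0 mul1r.
  by rewrite laplaceE//; apply: eq_Rintegral => x _; rewrite expr0 mul1r.
have E (x : R) : (1 - expR (- (b * x))) ^+ m.+1 * expR (- (a * x)) =
  (1 - expR (- (b * x))) ^+ m * expR (- (a * x)) -
  (1 - expR (- (b * x))) ^+ m * expR (- ((a + b) * x)).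
  rewrite exprSr mulrDl opprD expRD; ring.
have ab0 : 0 <= a + b by rewrite addr_ge0.
have S (rho : probability R R) : laplace_poly rho b a m.+1 =
    laplace_poly rho b a m - laplace_poly rho b (a + b) m.
  rewrite /laplace_poly; under eq_Rintegral do rewrite E.
  by rewrite RintegralB//; exact: laplace_poly_integrable.
by rewrite !S !IH.
Qed.

Lemma expR_ln2_lt (c x : R) : 0 < c -> c < x ->
  expR (- (ln 2 / c * x)) < 2^-1.
Proof.
move=> c0 cx; rewrite -[ltRHS]lnK ?posrE ?invr_gt0// ltr_expR lnV ?posrE// ltrN2.
have l2 : 0 < ln 2 :> R by rewrite ln_gt0// ltr1n.
by rewrite mulrAC ltr_pdivlMr// ltr_pM2l.
Qed.

Lemma expR_ln2_gt (c x : R) : 0 < c -> x < c ->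
  2^-1 < expR (- (ln 2 / c * x)).
Proof.
move=> c0 cx; rewrite -[ltLHS]lnK ?posrE ?invr_gt0// ltr_expR lnV ?posrE// ltrN2.
have l2 : 0 < ln 2 :> R by rewrite ln_gt0// ltr1n.
by rewrite mulrAC ltr_pdivrMr// ltr_pM2l.
Qed.

Lemma fine_measure_indic (rho : probability R R) (A : set R) (k : R) :
  measurable A -> A `<=` D ->
  rho.-integrable D (EFin \o (fun x => k * \1_A x)) /\
  \int[rho]_(x in D) (k * \1_A x) = k * fine (rho A).
Proof.
move=> mA AD.
have i1 : rho.-integrable D (EFin \o (\1_A : R -> R)).
  apply: (@bounded_integrable _ _ _ _ _ _ 1) => // x _.
  by rewrite indicE; case: (_ \in _); rewrite ?normr1 ?normr0.
split; first exact: (integrableZl _ k i1).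
rewrite RintegralZl// /Rintegral integral_indic//; congr (_ * fine (rho _)).
by rewrite setIidl.
Qed.

(** The two Bernoulli inequalities make the approximation of the tail
    indicator uniform away from [c], with errors (2 u(c2))^n from below and
    (2 u(c1))^(-n) from above. *)
Lemma tail_le (c1 c c2 : R) : 0 < c1 -> c1 < c -> c < c2 ->
  fine (mu `[c2, +oo[%classic) <= fine (nu `]c1, +oo[%classic).
Proof.
move=> c10 c1c cc2; have c0 : 0 < c by exact: lt_trans c1c.
pose l := ln 2 / c.
have l0 : 0 < l by rewrite divr_gt0// ln_gt0// ltr1n.
pose u (x : R) := expR (- (l * x)).
have u2 : u c2 < 2^-1 by exact: expR_ln2_lt.
have u1 : 2^-1 < u c1 by exact: expR_ln2_gt.
have u0 x : 0 < u x by exact: expR_gt0.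
have uN n x : expR (- ((n%:R * l) * x)) = u x ^+ n.
  by rewrite /u -expRM_natl; congr expR; ring.
have u_nincr x y : x <= y -> u y <= u x.
  by move=> xy; rewrite ler_expR lerN2 ler_pM2l.
have ule1 n x : 0 < x -> 0 <= u x ^+ n <= 1.
  move=> x0; rewrite exprn_ge0 ?(ltW (u0 _))//= exprn_ile1 ?(ltW (u0 _))//.
  by rewrite /u -expR0 ler_expR oppr_le0 mulr_ge0// ltW.
set A := `[c2, +oo[%classic; set B := `]c1, +oo[%classic.
have AD : A `<=` D.
  by move=> x; rewrite /A/= !in_itv/= !andbT; apply: lt_le_trans; exact: lt_trans cc2.
have BD : B `<=` D.
  by move=> x; rewrite /B/= !in_itv/= !andbT; exact: lt_trans.
(* [r n] and [q n] bound the errors on x >= c2 and on x <= c1. *)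
pose r n := (2 * u c2) ^+ n.
pose q n := ((2 * u c1) ^+ n)^-1.
pose phi n x := (1 - expR (- ((n%:R * l) * x))) ^+ (2 ^ n) * expR (- (0 * x)).
have phiE n x : phi n x = (1 - u x ^+ n) ^+ (2 ^ n).
  by rewrite /phi uN mul0r oppr0 expR0 mulr1.
have nl n : 0 <= n%:R * l by rewrite mulr_ge0// ltW.
have lower n : (1 - r n) * fine (mu A) <= laplace_poly mu (n%:R * l) 0 (2 ^ n).
  have [iA <-] := fine_measure_indic mu (1 - r n) (measurable_itv _) AD.
  apply: le_Rintegral => //; first exact: laplace_poly_integrable.
  move=> x Dx; rewrite -/(phi n x).
  move: (Dx); rewrite mem0y => x0.
  rewrite indicE; case: (boolP (x \in A)) => [xA|_] /=; last first.
    by rewrite mulr0; have /andP[] := laplace_poly_bounds (2 ^ n) (nl n) (lexx 0) x0.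
  rewrite mulr1 phiE; apply: le_trans (bernoulli_lb _ (ule1 n x x0)).
  rewrite lerD2l lerN2 /r exprMn natrX ler_wpM2l ?exprn_ge0//.
  rewrite lerXn2r ?nnegrE ?(ltW (u0 _))//; apply: u_nincr.
  by move: xA; rewrite inE /A/= in_itv/= andbT.
have upper n : laplace_poly nu (n%:R * l) 0 (2 ^ n) <= fine (nu B) + q n.
  have [iB EB] := fine_measure_indic nu 1 (measurable_itv _) BD.
  have [iD ED] := fine_measure_indic nu (q n) (measurable_itv _) (@subset_refl _ D).
  have q0 : 0 <= q n by rewrite invr_ge0 exprn_ge0// mulr_ge0// ltW.
  apply: (@le_trans _ _ (\int[nu]_(x in D) (1 * \1_B x + q n * \1_D x))).
    apply: le_Rintegral => //.
    - exact: laplace_poly_integrable.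
    - exact: (integrableD _ iB iD).
    move=> x Dx; rewrite -/(phi n x).
    move: (Dx); rewrite mem0y => x0.
    rewrite mul1r [X in _ <= _ + q n * X]indicE (mem_set Dx) mulr1.
    rewrite indicE; case: (boolP (x \in B)) => [xB|] /=.
      have /andP[_ h] := laplace_poly_bounds (2 ^ n) (nl n) (lexx 0) x0.
      by apply: (le_trans h); rewrite lerDl.
    rewrite notin_setE /B/= in_itv/= andbT => /negP; rewrite -leNgt => xc1.
    rewrite add0r phiE.
    have h := bernoulli_ub (2 ^ n) (ule1 n x x0).
    have p0 : 0 < (2 * u c1) ^+ n by rewrite exprn_gt0// mulr_gt0.
    rewrite /q -[leRHS]mul1r ler_pdivlMr//; apply: le_trans h.
    rewrite ler_wpM2l//.
      by rewrite exprn_ge0// subr_ge0; case/andP: (ule1 n x x0).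
    rewrite natrX exprMn; apply: (@le_trans _ _ (2 ^+ n * u x ^+ n)).
      rewrite ler_wpM2l ?exprn_ge0//.
      by rewrite lerXn2r ?nnegrE ?(ltW (u0 _))//; exact: u_nincr.
    by rewrite lerDr.
  rewrite RintegralD// EB ED mul1r lerD2l -[leRHS]mulr1 ler_wpM2l//.
  rewrite -lee_fin fineK ?fin_num_measure//; exact: probability_le1.
have rc : r n @[n --> \oo] --> 0.
  apply: cvg_expr; rewrite ger0_norm ?mulr_ge0 ?(ltW (u0 _))//; lra.
have qc : q n @[n --> \oo] --> 0.
  rewrite (_ : q = fun n => (2 * u c1)^-1 ^+ n); last by apply/funext => n; rewrite exprVn.
  apply: cvg_expr; rewrite ger0_norm ?invr_ge0 ?mulr_ge0 ?(ltW (u0 _))//.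
  rewrite invf_lt1 ?mulr_gt0//; lra.
have lim1 : (1 - r n) * fine (mu A) @[n --> \oo] --> (1 - 0) * fine (mu A).
  by apply: cvgMl; apply: cvgB => //; exact: cvg_cst.
have lim2 : fine (nu B) + q n @[n --> \oo] --> fine (nu B) + 0.
  by apply: cvgD => //; exact: cvg_cst.
rewrite -[leLHS]mul1r -[X in X * _]subr0 -[leRHS]addr0.
apply: (ler_cvg_to lim1 lim2); apply: nearW => n.
by apply: le_trans (lower n) _; rewrite laplace_polyE.
Qed.

End laplace_uniqueness.

Lemma open_tail_le (R : realType) (mu nu : probability R R) (c : R) :
  (forall s : R, 0 <= s ->
    \int[mu]_(x in `]0%R, +oo[) expR (- (s * x)) =
    \int[nu]_(x in `]0%R, +oo[) expR (- (s * x))) ->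
  0 < c -> (mu `]c, +oo[%classic <= nu `]c, +oo[%classic)%E.
Proof.
move=> H c0; rewrite [X in mu X]itvoyEbigcup.
pose F (k : nat) : set R := `[(c + k.+1%:R^-1)%R, +oo[%classic.
have mF k : measurable (F k) by exact: measurable_itv.
have mUF : measurable (\bigcup_k F k) by exact: bigcupT_measurable.
have ndF : nondecreasing_seq F.
  move=> m n mn; apply/subsetPset => x; rewrite /F/= !in_itv/= !andbT.
  by apply: le_trans; rewrite lerD2l lef_pV2 ?posrE ?ler_nat.
have cF := nondecreasing_cvg_mu (mu := mu) mF mUF ndF.
rewrite -(cvg_lim (@ereal_hausdorff R) cF); apply: lime_le.
  by apply/cvg_ex; exists (mu (\bigcup_k F k)).
apply: nearW => k /=.
have k0 : 0 < k.+1%:R^-1 :> R by rewrite invr_gt0.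
rewrite -(fineK (fin_num_measure mu _ (mF k))).
rewrite -(fineK (fin_num_measure nu _ (measurable_itv `]c, +oo[))) lee_fin.
apply: (@tail_le _ mu nu H c (c + k.+1%:R^-1 / 2)) => //; move: (_^-1) k0 => e e0; lra.
Qed.

Lemma laplace_unique (R : realType) (mu nu : probability R R) :
  mu `]0%R, +oo[%classic = 1%E -> nu `]0%R, +oo[%classic = 1%E ->
  (forall s : R, 0 <= s ->
    \int[mu]_(x in `]0%R, +oo[) expR (- (s * x)) =
    \int[nu]_(x in `]0%R, +oo[) expR (- (s * x))) ->
  forall A : set R, measurable A -> mu A = nu A.
Proof.
move=> mu1 nu1 H.
have full (rho : probability R R) (c : R) : rho `]0%R, +oo[%classic = 1%E ->
    c <= 0 -> rho `]c, +oo[%classic = 1%E.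
  move=> rho1 c0; apply/eqP; rewrite eq_le; apply/andP; split.
    exact: probability_le1.
  rewrite -rho1; apply: le_measure; rewrite ?inE//.
  by move=> x /=; rewrite !in_itv/= !andbT; exact: le_lt_trans.
have rays (c : R) : mu `]c, +oo[%classic = nu `]c, +oo[%classic.
  have [c0|c0] := leP c 0; first by rewrite (full mu c mu1 c0) (full nu c nu1 c0).
  apply/eqP; rewrite eq_le; apply/andP; split.
    exact: (open_tail_le H c0).
  by apply: (@open_tail_le _ nu mu c _ c0) => s s0; rewrite (H s s0).
move=> A mA; apply: (@measure_unique _ _ R (@RGenOInfty.G R) (fun k : nat => `](- k%:R)%R, +oo[%classic) _ _ _ _ mu nu) => //.
- exact: RGenOInfty.measurableE.
- move=> _ _ [x ->] [y ->]; exists (Num.max x y).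
  apply/seteqP; split=> z /=; rewrite !in_itv/= !andbT gt_max; first by case=> -> ->.
  by move=> /andP[].
- by move=> k; exists (- k%:R).
- apply/seteqP; split=> // x _; exists (Num.bound `|x|) => //=.
  rewrite in_itv/= andbT ltrNl; apply: le_lt_trans (archi_boundP (normr_ge0 x)).
  by rewrite -normrN ler_norm.
- by move=> _ [c ->]; exact: rays.
- by move=> k; rewrite (le_lt_trans (probability_le1 _ _)) ?ltry.
Qed.

(** * The law of the limit *)

Lemma cvg0_halving (R : realType) (u : nat -> R) (N : nat) :
  (forall n, 0 <= u n) -> (forall n, (N <= n)%N -> u n.+1 <= 2^-1 * u n) ->
  u n @[n --> \oo] --> 0.
Proof.
move=> u0 uh; rewrite -(@cvg_shiftn N).
have le n : u (n + N)%N <= u N * 2^-1 ^+ n.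
  elim: n => [|n IH]; first by rewrite expr0 mulr1.
  rewrite addSn (le_trans (uh _ (leq_addl _ _)))// exprS mulrCA ler_wpM2l//.
apply: (@squeeze_cvgr _ _ _ _ (fun=> 0) (fun n => u N * 2^-1 ^+ n)).
- by apply: nearW => n; rewrite u0 le.
- exact: cvg_cst.
- rewrite -[X in _ --> X](mulr0 (u N)); apply: cvgMr.
  by apply: cvg_expr; rewrite ger0_norm// invf_lt1// ltr1n.
Qed.

(** [Gamma_ratio_ub] at b + alpha with exponent 1 - alpha: over one step of
    length alpha the transform grows by a factor of order b^(1 - alpha) only. *)
Lemma stable_mellin_step (R : realType) (alpha b : R) : 0 < alpha ->
  alpha < 1 -> - alpha < b ->
  stable_mellin alpha (b + alpha) <=
    alpha^-1 * (b + alpha) `^ (1 - alpha) * stable_mellin alpha b.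
Proof.
move=> a0 a1 ba; rewrite /stable_mellin.
have z0 : 0 < b + alpha by lra.
have b1 : 0 < b + 1 by lra.
have q := stable_arg_gt0 a0 ba.
have p01 : 0 <= 1 - alpha <= 1 by apply/andP; split; lra.
have := Gamma_ratio_ub z0 p01.
rewrite (_ : b + alpha + (1 - alpha) = b + 1); last by ring.
rewrite (_ : (b + alpha) / alpha + 1 = (b / alpha + 1) + 1); last first.
  by field; rewrite gt_eqF.
rewrite (GammaS q) (GammaS z0).
have G1 := Gamma_gt0 b1; have G2 := Gamma_gt0 q; have G3 := Gamma_gt0 z0.
move: (Gamma (b + 1)) (Gamma (b / alpha + 1)) (Gamma (b + alpha)) (_ `^ _) G1 G2 G3 => g1 g2 g3 w h1 h2 h3 H.
have -> : (b / alpha + 1) * g2 / ((b + alpha) * g3) = (alpha^-1 * g2) * g3^-1.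
  by field; rewrite !gt_eqF.
have -> : alpha^-1 * w * (g2 / g1) = (alpha^-1 * g2) * (w / g1) by ring.
rewrite ler_wpM2l ?mulr_ge0 ?invr_ge0 ?(ltW a0) ?(ltW h2)//.
by rewrite ler_pdivlMr// mulrC ler_pdivrMr.
Qed.

(** By [stable_mellin_step] the quotient of the terms of index n + 1 and n is
    at most C / (2 (n+1)^alpha), which is eventually at most 1/2. *)
Lemma mittag_leffler_term_cvg0 (R : realType) (alpha theta s c : R) :
  0 < alpha -> alpha < 1 -> - alpha < theta -> 0 <= s -> 0 <= c ->
  s ^+ n * (stable_mellin alpha (theta + n%:R * alpha) * c) / n`!%:R
    @[n --> \oo] --> 0.
Proof.
move=> a0 a1 ta s0 c0.
have bn n : - alpha < theta + n%:R * alpha.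
  have : 0 <= n%:R * alpha by rewrite mulr_ge0// ltW.
  lra.
have mn n := stable_mellin_gt0 a0 a1 (bn n).
pose C := 2 * (s / alpha * (`|theta| + alpha) `^ (1 - alpha)).
have C0 : 0 <= C by rewrite !mulr_ge0 ?powR_ge0// invr_ge0 ltW.
apply: (@cvg0_halving _ _ (Num.bound (C `^ alpha^-1))) => n.
  apply: divr_ge0 => //; apply: mulr_ge0; first exact: exprn_ge0.
  by apply: mulr_ge0 => //; exact: ltW (mn n).
move=> Nn; have n1 : 0 < n.+1%:R :> R by rewrite ltr0n.
have Cn : C <= n.+1%:R `^ alpha.
  have -> : C = (C `^ alpha^-1) `^ alpha by rewrite -powRrM mulVf ?gt_eqF// powRr1.
  apply: ge0_ler_powR; rewrite ?nnegrE ?powR_ge0 ?(ltW a0) ?(ltW n1)//.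
  apply: le_trans (ltW (archi_boundP (powR_ge0 _ _))) _.
  by rewrite ler_nat leqW.
have zb : (theta + n.+1%:R * alpha) `^ (1 - alpha) <=
    (`|theta| + alpha) `^ (1 - alpha) * n.+1%:R `^ (1 - alpha).
  rewrite -powRM ?addr_ge0 ?(ltW a0) ?(ltW n1)//.
  have z0 : 0 <= theta + n.+1%:R * alpha.
    rewrite -natr1 (_ : _ + _ = theta + n%:R * alpha + alpha); last by ring.
    by move: (n%:R * alpha) (bn n) => na; lra.
  have p0 : 0 <= 1 - alpha by lra.
  have ta0 : 0 <= `|theta| + alpha by rewrite addr_ge0 ?(ltW a0).
  apply: (ge0_ler_powR p0); rewrite ?nnegrE// ?mulr_ge0//.
  rewrite [leRHS]mulrDl [in leRHS](mulrC alpha) lerD//.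
  by apply: (le_trans (ler_norm _)); rewrite ler_peMr// ler1n.
have := stable_mellin_step a0 a1 (bn n).
rewrite (_ : theta + n%:R * alpha + alpha = theta + n.+1%:R * alpha); last first.
  by rewrite -natr1; ring.
move=> step; have {step zb}step : stable_mellin alpha (theta + n.+1%:R * alpha) <=
    alpha^-1 * ((`|theta| + alpha) `^ (1 - alpha) * n.+1%:R `^ (1 - alpha)) *
    stable_mellin alpha (theta + n%:R * alpha).
  apply: (le_trans step); rewrite ler_wpM2r ?(ltW (mn _))//.
  by rewrite ler_wpM2l// invr_ge0 ltW.
move: (mn n) step; move: (stable_mellin _ _) (stable_mellin _ _) => m1 m0 m00 step.
have f0 : 0 < n`!%:R :> R by rewrite ltr0n fact_gt0.
rewrite exprS factS natrM.
apply: (@le_trans _ _ (s * s ^+ n * ((alpha^-1 * ((`|theta| + alpha) `^ (1 - alpha) *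
   n.+1%:R `^ (1 - alpha)) * m0) * c) / (n.+1%:R * n`!%:R))).
  rewrite ler_wpM2r ?invr_ge0 ?mulr_ge0 ?(ltW n1) ?(ltW f0)//.
  by rewrite ler_wpM2l ?mulr_ge0 ?exprn_ge0// ler_wpM2r.
have nE : n.+1%:R = n.+1%:R `^ (1 - alpha) * n.+1%:R `^ alpha :> R.
  rewrite -powRD; first by rewrite subrK powRr1// ltW.
  by rewrite (gt_eqF n1) implybT.
have p1 := powR_gt0 (1 - alpha) n1; have p2 := powR_gt0 alpha n1.
rewrite [X in _ / (X * _)]nE.
move: Cn; rewrite /C.
move: (n.+1%:R `^ (1 - alpha)) (n.+1%:R `^ alpha) p1 p2 => x y x0 y0.
move: (_ `^ (1 - alpha)) => k Cn.
have -> : s * s ^+ n * (alpha^-1 * (k * x) * m0 * c) / (x * y * n`!%:R) =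
   (s / alpha * k / y) * (s ^+ n * (m0 * c) / n`!%:R).
  by field; rewrite !gt_eqF.
rewrite ler_wpM2r ?mulr_ge0 ?exprn_ge0 ?invr_ge0 ?(ltW m00) ?(ltW f0)//.
by rewrite ler_pdivrMr// ler_pdivlMl// .
Qed.

Lemma density_probability (R : realType) (D : set R) (f : R -> R) :
  measurable D -> measurable_fun D f -> (forall x, D x -> 0 <= f x) ->
  (\int[lebesgue_measure]_(x in D) (f x)%:E = 1)%E ->
  exists tau : probability R R, has_density_on tau D f.
Proof.
move=> mD mf f0 f1.
have fD0 x : (0 <= ((f \_ D) x)%:E)%E.
  by rewrite lee_fin patchE; case: ifPn => //; rewrite inE => /f0.
have mfD : measurable_fun setT (fun x => ((f \_ D) x)%:E).
  by apply/measurable_EFinP; apply/(measurable_restrictT _ _).1.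
pose m (A : set R) : \bar R := (\int[lebesgue_measure]_(x in A) ((f \_ D) x)%:E)%E.
have mE A : m A = (\int[lebesgue_measure]_(x in A `&` D) (f x)%:E)%E.
  rewrite /m integral_mkcondr; apply: eq_integral => x _.
  by rewrite !patchE; case: ifP.
have m0 : m set0 = 0%E by rewrite /m integral_set0.
have mge0 A : (0 <= m A)%E by apply: integral_ge0 => x _.
have msigma : semi_sigma_additive m.
  move=> /= F mF tF mUF; rewrite /m ge0_integral_bigcup//=; last first.
    exact: measurable_funTS.
  apply: is_cvg_ereal_nneg_natsum_cond => n _ _.
  by apply: integral_ge0.
have mT : m setT = 1%E by rewrite mE setTI.
pose mm : {measure set R -> \bar R} := HB.pack m (isMeasure.Build _ _ _ m m0 mge0 msigma).
have mmT : mm setT = 1%E by exact: mT.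
pose tau : probability R R := HB.pack m (isMeasure.Build _ _ _ m m0 mge0 msigma)
  (Measure_isProbability.Build _ _ _ mm mmT).
by exists tau; split => // A mA; exact: mE.
Qed.

Section limit_law.
Context d (Omega : measurableType d) (R : realType) (P : probability Omega R).
Variables (alpha theta : R) (V : nat -> {RV P >-> R}).
Hypotheses (a0 : 0 < alpha) (a1 : alpha < 1) (ta : - alpha < theta).
Hypothesis indepV : independent_RVs V.
Hypothesis betaV : forall j : nat,
  is_beta (1 - alpha) (theta + j.+1%:R * alpha) (V j).

(** The upper limit gives a random variable that is defined everywhere; where
    the centred epochs converge to X it is e^(-X). *)
Definition epoch_limit (w : Omega) : R :=
  expR (fine (limn_esup (fun n => (- centred_epoch alpha V n w)%:E))).

Lemma measurable_epoch_limit : measurable_fun setT epoch_limit.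
Proof.
apply: measurableT_comp => //; apply: measurableT_comp => //.
apply: measurable_fun_limn_esup => n; apply/measurable_EFinP.
by apply: measurableT_comp => //; exact: measurable_centred_epoch.
Qed.

Lemma epoch_limit_gt0 w : 0 < epoch_limit w.
Proof. exact: expR_gt0. Qed.

Lemma centred_epoch_cvg_limit_ae :
  {ae P, forall w, centred_epoch alpha V n w @[n --> \oo] --> - ln (epoch_limit w)}.
Proof.
apply: filterS (centred_epoch_cvg_ae a0 a1 ta indepV betaV) => w /cvg_ex[l cl].
have cN : (- centred_epoch alpha V n w)%:E @[n --> \oo] --> (- l)%:E.
  by apply: cvg_EFin; [exact: nearW|exact: cvgN].
rewrite /epoch_limit is_cvg_limn_esupE; last by apply/cvg_ex; exists (- l)%:E.
by rewrite (cvg_lim _ cN)//= expRK opprK.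
Qed.

Let M (k : nat) : R :=
  stable_mellin alpha (theta + k%:R * alpha) / stable_mellin alpha theta.

(* The exponent - alpha makes the numbers [M k] grow slowly enough to determine
   a law. *)
Let U (w : Omega) : R := expR (- alpha * ln (epoch_limit w)).

(** The Taylor bounds hold at each finite [n] and pass to the limit: the
    moments converge by [near1_moment_ratio], the Laplace transforms by
    dominated convergence.  The moments of the limit itself are never
    computed. *)
Lemma limit_laplace (s : R) (K : nat) : 0 <= s ->
  `|\int[P]_w expR (- (s * U w)) - \sum_(0 <= k < K) (-1) ^+ k / k`!%:R * (s ^+ k * M k)|
    <= s ^+ K * M K / K`!%:R.
Proof.
move=> s0.
pose Un n w := expR (alpha * centred_epoch alpha V n w).
pose b n k := s ^+ k * (M k * moment_ratio alpha theta (k%:R * alpha) n).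
have ka k : 0 <= k%:R * alpha by rewrite mulr_ge0// ltW.
have mUn n : measurable_fun setT (Un n).
  apply: measurableT_comp => //; apply: measurable_funM => //.
  exact: measurable_centred_epoch.
have sUn0 n w : 0 <= s * Un n w by rewrite mulr_ge0// expR_ge0.
have Eb n k : (\int[P]_w ((s * Un n w) ^+ k)%:E = (b n k)%:E)%E.
  under eq_integral do rewrite exprMn EFinM.
  rewrite ge0_integralZl//; last 3 first.
  - by apply/measurable_EFinP; exact: measurable_funX.
  - by move=> w _; rewrite lee_fin exprn_ge0// expR_ge0.
  - by rewrite lee_fin exprn_ge0.
  rewrite /b EFinM; congr (_ * _)%E.
  rewrite -(centred_epoch_moment a0 a1 ta indepV betaV n (ka k)).
  by apply: eq_integral => w _; rewrite /Un -expRM_natl mulrA.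
have bc k : b n k @[n --> \oo] --> s ^+ k * M k.
  rewrite (_ : s ^+ k * M k = s ^+ k * (M k * 1)); last by rewrite mulr1.
  apply: cvgMr; apply: cvgMr.
  exact: near1_cvg (near1_moment_ratio a0 a1 ta (ka k)).
have mUlim : measurable_fun setT U.
  apply: measurableT_comp => //; apply: measurable_funM => //.
  by apply: measurableT_comp => //; exact: measurable_epoch_limit.
have mexp (Y : Omega -> R) : measurable_fun setT Y ->
    measurable_fun setT (fun w => expR (- (s * Y w))).
  move=> mY; apply: measurableT_comp => //; apply: measurableT_comp => //.
  exact: measurable_funM.
have ac : \int[P]_w expR (- (s * Un n w)) @[n --> \oo] --> \int[P]_w expR (- (s * U w)).
  have [] := @dominated_convergence _ _ _ P setT measurableT
     (fun n w => (expR (- (s * Un n w)))%:E) (fun w => (expR (- (s * U w)))%:E) (cst 1%E).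
  - by move=> n; apply/measurable_EFinP; exact: mexp.
  - by apply/measurable_EFinP; exact: mexp.
  - apply: filterS centred_epoch_cvg_limit_ae => w cw _.
    apply: cvg_EFin; first exact: nearW.
    have c1 : alpha * centred_epoch alpha V n w @[n --> \oo] --> alpha * - ln (epoch_limit w).
      exact: cvgMr.
    have c2 : Un n w @[n --> \oo] --> U w.
      rewrite /U mulNr -mulrN; apply: continuous_cvg c1; exact: continuous_expR.
    have c3 : - (s * Un n w) @[n --> \oo] --> - (s * U w).
      by apply: cvgN; apply: cvgMr.
    apply: continuous_cvg c3; exact: continuous_expR.
  - exact: finite_measure_integrable_cst.
  - apply: aeW => w n _; rewrite /= lee_fin ger0_norm ?expR_ge0//.
    by rewrite -expR0 ler_expR oppr_le0.
  - move=> iU _ H; apply: fine_cvg; rewrite fineK; first exact: H.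
    exact: integrable_fin_num.
have lim1 : `|\int[P]_w expR (- (s * Un n w)) -
    \sum_(0 <= k < K) (-1) ^+ k / k`!%:R * b n k| @[n --> \oo] -->
    `|\int[P]_w expR (- (s * U w)) -
    \sum_(0 <= k < K) (-1) ^+ k / k`!%:R * (s ^+ k * M k)|.
  apply: cvg_norm; apply: cvgB; first exact: ac.
  by apply: cvg_big => [|k _]; [exact: add_continuous|exact: cvgMr].
have lim2 : b n K / K`!%:R @[n --> \oo] --> s ^+ K * M K / K`!%:R.
  exact: cvgMl.
apply: (ler_cvg_to lim1 lim2); apply: nearW => n.
apply: laplace_moment_approx => //.
exact: measurable_funM.
Qed.

End limit_law.

Lemma laplace_unique_law d1 d2 (T1 : measurableType d1) (T2 : measurableType d2)
    (R : realType) (P : probability T1 R) (Q : probability T2 R)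
    (X : T1 -> R) (Y : T2 -> R) :
  measurable_fun setT X -> measurable_fun setT Y ->
  (forall w, 0 < X w) -> (forall w, 0 < Y w) ->
  (forall s, 0 <= s -> \int[P]_w expR (- (s * X w)) = \int[Q]_w expR (- (s * Y w))) ->
  forall A, measurable A -> P (X @^-1` A) = Q (Y @^-1` A).
Proof.
move=> mX mY X0 Y0 XY A mA.
pose X' : {RV P >-> R} := HB.pack X (isMeasurableFun.Build _ _ _ _ X mX).
pose Y' : {RV Q >-> R} := HB.pack Y (isMeasurableFun.Build _ _ _ _ Y mY).
have full d (T : measurableType d) (m : probability T R) (Z : {RV m >-> R}) :
    (forall w, 0 < Z w) -> distribution m Z `]0%R, +oo[%classic = 1%E.
  move=> Z0; rewrite /distribution /pushforward (_ : _ @^-1` _ = setT).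
    exact: probability_setT.
  by apply/seteqP; split => w // _; rewrite /= in_itv/= andbT.
have lap d (T : measurableType d) (m : probability T R) (Z : {RV m >-> R}) s :
    (forall w, 0 < Z w) ->
    \int[distribution m Z]_(x in `]0%R, +oo[) expR (- (s * x)) =
    \int[m]_w expR (- (s * Z w)).
  move=> Z0; rewrite /Rintegral; congr fine.
  rewrite ge0_integral_pushforward//; last first.
    apply/measurable_EFinP; apply: measurable_funTS.
    apply: measurableT_comp => //; apply: measurableT_comp => //.
  rewrite (_ : _ @^-1` _ = setT)//.
  by apply/seteqP; split => w // _; rewrite /= in_itv/= andbT.
rewrite -[LHS]/(distribution P X' A) -[RHS]/(distribution Q Y' A).
apply: laplace_unique => //; [exact: full|exact: full|].
by move=> s s0; rewrite !lap//; exact: XY.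
Qed.

Section tilted_law.
Context (R : realType) (alpha theta : R) (f : R -> R).
Hypotheses (a0 : 0 < alpha) (a1 : alpha < 1) (ta : - alpha < theta).
Hypothesis hf : is_positive_stable_density alpha f.
Let g := tilted_stable_density alpha theta f.

Let c0 : 0 < stable_mellin alpha theta.
Proof. exact: stable_mellin_gt0. Qed.

Lemma tilted_stable_densityE t :
  g t = (stable_mellin alpha theta)^-1 * (t `^ (- theta) * f t).
Proof. by rewrite /g /tilted_stable_density /stable_mellin invf_div mulrA. Qed.

Lemma tilted_stable_density_ge0 t : 0 < t -> 0 <= g t.
Proof.
move=> t0; case: hf => mu [[_ f0 _] _].
rewrite tilted_stable_densityE; apply: mulr_ge0; first by rewrite invr_ge0 ltW.
by rewrite mulr_ge0 ?powR_ge0// f0//= in_itv/= t0.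
Qed.

Lemma measurable_tilted_stable_density : measurable_fun (`]0%R, +oo[%classic : set R) g.
Proof.
case: hf => mu [[mf _ _] _].
rewrite (_ : g = fun t => (stable_mellin alpha theta)^-1 * (t `^ (- theta) * f t)); last first.
  by apply/funext => t; exact: tilted_stable_densityE.
apply: measurable_funM => //; apply: measurable_funM => //.
by apply: measurable_funTS; exact: measurable_powR.
Qed.

(** Tilting by t^(- theta) shifts the argument of [stable_mellin]. *)
Lemma tilted_stable_moment p : - alpha < theta + p ->
  (\int[lebesgue_measure]_(t in `]0%R, +oo[) (t `^ (- p) * g t)%:E =
   (stable_mellin alpha (theta + p) / stable_mellin alpha theta)%:E)%E.
Proof.
move=> tpa; case: (hf) => mu [[mf f0 _] _].
transitivity (((stable_mellin alpha theta)^-1)%:E *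
   \int[lebesgue_measure]_(t in `]0%R, +oo[) (t `^ (- (theta + p)) * f t)%:E)%E.
  rewrite -ge0_integralZl//; last 3 first.
  - apply/measurable_EFinP; apply: measurable_funM => //.
    by apply: measurable_funTS; exact: measurable_powR.
  - by move=> t t0; rewrite lee_fin mulr_ge0 ?powR_ge0// f0.
  - by rewrite lee_fin invr_ge0 ltW.
  apply: eq_integral => t; rewrite inE mem0y => t0.
  rewrite -EFinM; congr EFin; rewrite tilted_stable_densityE.
  rewrite (_ : - (theta + p) = - theta - p); last by ring.
  rewrite powRD ?(gt_eqF t0) ?implybT//.
  by move: (_^-1) (t `^ _) (t `^ _) => x y z; ring.
by rewrite (stable_moment a0 a1 hf tpa) -EFinM -/(stable_mellin _ _) mulrC.
Qed.

Lemma tilted_stable_density_probability :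
  exists tau : probability R R, has_density_on tau `]0%R, +oo[ g.
Proof.
apply: density_probability => //.
- exact: measurable_tilted_stable_density.
- by move=> x; rewrite mem0y; exact: tilted_stable_density_ge0.
- rewrite -[RHS](_ : (stable_mellin alpha (theta + 0) / stable_mellin alpha theta)%:E = _).
    rewrite -tilted_stable_moment ?addr0//; apply: eq_integral => x.
    by rewrite inE mem0y => x0; rewrite oppr0 powRr0 mul1r.
  by rewrite addr0 divff// gt_eqF.
Qed.

Lemma tilted_stable_power_moment (tau : probability R R) (k : nat) :
  has_density_on tau `]0%R, +oo[ g ->
  (\int[tau]_t (expR (- alpha * ln t) ^+ k)%:E =
   (stable_mellin alpha (theta + k%:R * alpha) / stable_mellin alpha theta)%:E)%E.
Proof.
move=> tg; rewrite -tilted_stable_moment; last first.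
  by rewrite (lt_le_trans ta)// lerDl mulr_ge0// ltW.
rewrite (ge0_integral_density _ tg)//; last first.
  apply: (@measurable_funX _ _ _ setT (fun x : R => expR (- alpha * ln x))).
  apply: measurableT_comp => //.
  by apply: measurable_funM => //; exact: measurable_ln.
apply: eq_integral => x; rewrite inE mem0y => x0; congr (_ * _)%:E.
by rewrite (powR_expR _ x0) -expRM_natl; congr expR; ring.
Qed.

End tilted_law.

Lemma eq_of_approx (R : realType) (x y : R) (a b : nat -> R) :
  (forall n, `|x - a n| <= b n) -> (forall n, `|y - a n| <= b n) ->
  b n @[n --> \oo] --> 0 -> x = y.
Proof.
move=> xa ya b0.
have lim (z : R) : (forall n, `|z - a n| <= b n) -> a n @[n --> \oo] --> z.
  move=> za; apply/cvgrPdist_le => e e0; near=> n.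
  apply: (le_trans (za n)); apply: (le_trans (ler_norm _)).
  rewrite -[b n]subr0 distrC; near: n.
  by move/cvgrPdist_le : b0; exact.
exact: cvg_unique (lim _ xa) (lim _ ya).
Unshelve. all: by end_near. Qed.

Section law_of_limit.
Context d (Omega : measurableType d) (R : realType) (P : probability Omega R).
Variables (alpha theta : R) (V : nat -> {RV P >-> R}) (f : R -> R).
Hypotheses (a0 : 0 < alpha) (a1 : alpha < 1) (ta : - alpha < theta).
Hypothesis indepV : independent_RVs V.
Hypothesis betaV : forall j : nat,
  is_beta (1 - alpha) (theta + j.+1%:R * alpha) (V j).
Hypothesis hf : is_positive_stable_density alpha f.

(** The variable e^(- alpha log T) under [P] and its analogue under the tilted
    law have the same Taylor bounds at every order, hence the same Laplace
    transform and the same law; [h] recovers T from it. *)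
Lemma epoch_limit_density (A : set R) : measurable A ->
  (P (epoch_limit alpha V @^-1` A) =
   \int[lebesgue_measure]_(t in A `&` `]0%R, +oo[)
     (tilted_stable_density alpha theta f t)%:E)%E.
Proof.
move=> mA.
have [tau tg] := tilted_stable_density_probability a0 a1 ta hf.
pose X w := expR (- alpha * ln (epoch_limit alpha V w)).
pose Y (t : R) := expR (- alpha * ln t).
have mX : measurable_fun setT X.
  apply: measurableT_comp => //; apply: measurable_funM => //.
  by apply: measurableT_comp => //; exact: measurable_epoch_limit.
have mY : measurable_fun setT Y.
  by apply: measurableT_comp => //; apply: measurable_funM => //; exact: measurable_ln.
pose M k := stable_mellin alpha (theta + k%:R * alpha) / stable_mellin alpha theta.
have lapY (s : R) (K : nat) : 0 <= s ->
  `|\int[tau]_t expR (- (s * Y t)) -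
    \sum_(0 <= k < K) (-1) ^+ k / k`!%:R * (s ^+ k * M k)|
    <= s ^+ K * M K / K`!%:R.
  move=> s0; apply: (@laplace_moment_approx _ _ _ tau (fun t => s * Y t) (fun k => s ^+ k * M k)).
  - exact: measurable_funM.
  - by move=> t; rewrite mulr_ge0// expR_ge0.
  - move=> k; under eq_integral do rewrite exprMn EFinM.
    rewrite ge0_integralZl//; last 3 first.
    + by apply/measurable_EFinP; exact: measurable_funX.
    + by move=> w _; rewrite lee_fin exprn_ge0// expR_ge0.
    + by rewrite lee_fin exprn_ge0.
    by rewrite (tilted_stable_power_moment a0 a1 ta hf k tg) -EFinM.
have XY (s : R) : 0 <= s ->
    \int[P]_w expR (- (s * X w)) = \int[tau]_t expR (- (s * Y t)).
  move=> s0; apply: eq_of_approx.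
  - by move=> K; exact: (limit_laplace a0 a1 ta indepV betaV K s0).
  - by move=> K; exact: (lapY s K s0).
  - apply: mittag_leffler_term_cvg0 => //.
    by rewrite invr_ge0 ltW// stable_mellin_gt0.
pose h (u : R) := expR (- alpha^-1 * ln u).
have mh : measurable_fun setT h.
  by apply: measurableT_comp => //; apply: measurable_funM => //; exact: measurable_ln.
have mB : measurable (h @^-1` A) by rewrite -[_ @^-1` _]setTI; exact: mh.
have hK (t : R) : 0 < t -> h (expR (- alpha * ln t)) = t.
  move=> t0; rewrite /h expRK mulrA mulrNN mulVf ?gt_eqF// mul1r.
  by rewrite lnK// posrE.
transitivity (P (X @^-1` (h @^-1` A))).
  congr (P _); apply/funext => w; rewrite /preimage/= /X hK//.
  exact: epoch_limit_gt0.
rewrite (laplace_unique_law mX mY _ _ XY mB); try by move=> w; exact: expR_gt0.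
case: tg => _ _ ->; last first.
  by rewrite -[_ @^-1` _]setTI; exact: mY.
congr (integral _ _ _); apply/seteqP; split => t /= [].
  by rewrite in_itv/= andbT => + t0; rewrite hK.
by rewrite in_itv/= andbT => + t0; rewrite hK.
Qed.

End law_of_limit.

(** * The counting process *)

Section counting.
Context (T : Type) (R : realType) (V : nat -> T -> R) (w : T).
Let S n := renewal_epoch V n w.
Hypothesis S_nd : {homo S : m n / (m <= n)%N >-> m <= n}.
Hypothesis S_unbounded : forall t, exists n, t < S n.

Lemma renewal_count_max (t : R) : 0 <= t ->
  S (renewal_count V t w) <= t /\
  (forall n, S n <= t -> (n <= renewal_count V t w)%N).
Proof.
move=> t0; have [m tm] := S_unbounded t.
have ex0 : exists n, S n <= t.
  by exists 0%N; rewrite /S /renewal_epoch big_ord0.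
have ub n : S n <= t -> (n <= m)%N.
  move=> nt; rewrite leqNgt; apply/negP => /ltnW/S_nd mn.
  by move: (le_lt_trans (le_trans mn nt) tm); rewrite ltxx.
rewrite /renewal_count; set A := (X in xget _ X).
suff : A (xget 0%N A) by case.
apply: xgetPex; have [N NA Nmax] := ex_maxnP ex0 ub.
by exists N; split => // k; exact: Nmax.
Qed.

Lemma renewal_count_bracket (t : R) : 0 <= t ->
  S (renewal_count V t w) <= t < S (renewal_count V t w).+1.
Proof.
move=> /renewal_count_max[-> le]/=; rewrite ltNge; apply/negP => /le.
by rewrite ltnn.
Qed.

Lemma renewal_count_cvgy : renewal_count V t w @[t --> +oo] --> \oo.
Proof.
apply/cvgnyPge => m; near=> t.
have t0 : 0 <= t by near: t; exact: nbhs_pinfty_ge.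
by apply: (renewal_count_max t0).2; near: t; apply: nbhs_pinfty_ge; rewrite num_real.
Unshelve. all: by end_near. Qed.

End counting.

(** With r n = T_n - kap log n + log alpha, the inequalities
    T_N <= t < T_(N+1) place the centred time between r N and
    r (N + 1) + kap (log (N + 1) - log N), and both tend to [l]. *)
Lemma renewal_count_asymp (T : Type) (R : realType) (V : nat -> T -> R) (w : T)
    (alpha l : R) :
  0 < alpha -> alpha < 1 ->
  {homo (fun n => renewal_epoch V n w) : m n / (m <= n)%N >-> m <= n} ->
  log_scale alpha n - renewal_epoch V n w @[n --> \oo] --> - l ->
  t - (alpha^-1 - 1) * ln (renewal_count V t w)%:R + ln alpha
    @[t --> +oo] --> l.
Proof.
move=> a0 a1 S_nd; set S := fun n => renewal_epoch V n w.
set kap := alpha^-1 - 1 => cS.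
have kap0 : 0 < kap by rewrite subr_gt0 invf_gt1.
pose r n := S n - kap * ln n%:R + ln alpha.
have rl : r n @[n --> \oo] --> l.
  rewrite -[l]opprK (_ : r = fun n => - (log_scale alpha n - S n)); first exact: cvgN.
  by apply/funext => n; rewrite /r /log_scale -/kap opprB opprB addrA addrAC.
have unb (t : R) : exists n, t < S n.
  have [n tn] : exists n, t < S n; last by exists n.
  near \oo => n; exists n.
  have rn : l - 1 < r n.
    by near: n; apply: (cvgr_gt l rl); lra.
  have n0 : (0 < n)%N by near: n; exact: nbhs_infty_gt.
  have : (t + ln alpha - (l - 1)) / kap <= ln n%:R.
    rewrite -ler_expR lnK ?posrE ?ltr0n//; apply: ltW.
    apply: lt_le_trans (archi_boundP (expR_ge0 _)) _; rewrite ler_nat.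
    by near: n; exact: nbhs_infty_ge.
  rewrite ler_pdivrMr// [leRHS]mulrC; move: rn; rewrite /r.
  by move: (kap * ln _) => q; lra.
have cN := renewal_count_cvgy S_nd unb.
pose N t := renewal_count V t w.
have low : r (N t) @[t --> +oo] --> l by exact: cvg_comp cN rl.
pose u n := r n.+1 + kap * (ln n.+1%:R - ln n%:R).
have ul : u n @[n --> \oo] --> l.
  rewrite -[l]addr0 -(mulr0 kap); apply: cvgD; first by rewrite (cvg_shiftS r).
  apply: cvgMr.
  apply: (@squeeze_cvgr _ _ _ _ (fun=> 0) (fun n : nat => n%:R^-1 : R)).
  - near=> n; have n0 : (0 < n)%N by near: n; exact: nbhs_infty_gt.
    by rewrite ln_succ_sub// subr_ge0 ler_ln ?posrE ?ltr0n// ler_nat leqnSn.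
  - exact: cvg_cst.
  - rewrite -(cvg_shiftS (fun n : nat => n%:R^-1 : R)); exact: cvg_harmonic.
have up : u (N t) @[t --> +oo] --> l by exact: cvg_comp cN ul.
apply: (squeeze_cvgr _ low up); near=> t.
have t0 : 0 <= t by near: t; exact: nbhs_pinfty_ge.
have /andP[b1 b2] : S (N t) <= t < S (N t).+1 by exact: renewal_count_bracket.
rewrite /u /r -/(N t) mulrBr; move: b1 b2.
move: (kap * ln (N t)%:R) (kap * ln _) (S (N t)) (S _) => x y p q b1 b2.
by apply/andP; split; lra.
Unshelve. all: by end_near. Qed.

Theorem theorem1 (R : realType) (alpha theta : R)
    (halpha0 : 0 < alpha) (halpha1 : alpha < 1) (htheta : - alpha < theta)
    (f_alpha : R -> R) (hf : is_positive_stable_density alpha f_alpha)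
    (d : measure_display) (Omega : measurableType d)
    (P : probability Omega R) (V : nat -> {RV P >-> R})
    (hindep : independent_RVs V)
    (hbeta : forall j : nat,
      is_beta (1 - alpha) (theta + j.+1%:R * alpha) (V j)) :
  exists T_alpha_theta : {RV P >-> R},
    has_density_on (distribution P T_alpha_theta) `]0, +oo[
      (tilted_stable_density alpha theta f_alpha) /\
    {ae P, forall w,
      t - (alpha^-1 - 1) * ln (renewal_count V t w)%:R + ln alpha
        @[t --> +oo] --> ln (T_alpha_theta w)}.
Proof.
pose L := epoch_limit alpha V.
have mL : measurable_fun setT L by exact: measurable_epoch_limit.
pose T : {RV P >-> R} := HB.pack L (isMeasurableFun.Build _ _ _ _ L mL).
exists T; split.
  split.
  - exact: measurable_tilted_stable_density.
  - by move=> x; rewrite mem0y; exact: tilted_stable_density_ge0.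
  - by move=> A mA; exact: (epoch_limit_density halpha0 halpha1 htheta hindep hbeta hf mA).
apply: filterS2 (centred_epoch_cvg_limit_ae halpha0 halpha1 htheta hindep hbeta)
  (beta_range_ae hbeta) => w cw V01.
apply: renewal_count_asymp cw => // m n.
exact: (renewal_epoch_nd V01).
Qed.
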